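(* Let $\mathcal{P}_t=e^{t\mathcal{L}}$ be a primitive quantum Markov semigroup satisfying the $\sigma$-KMS detailed balance condition for its full-rank invariant state $\sigma$. (a) If the dual $q$-Beckner inequality $(\mathrm{Bec}'_q)$ holds with constants $\beta_q$ such that $\limsup_{q\to 2^-}\beta_q>0$, then the log-Sobolev inequality (LSI) holds with a constant $\beta\ge \frac12\limsup_{q\to2^-}\beta_q$. (b) Conversely, if (LSI) holds with constant $\beta>0$, then for every $q\in(0,2)$ the inequality $(\mathrm{Bec}'_q)$ holds with a constant $\beta_q\ge q\beta$.
   Context: $\mathcal H$ is a finite-dimensional Hilbert space, $\mathcal B(\mathcal H)$ the operators on it, $\mathcal D_+(\mathcal H)$ the full-rank density operators. A quantum Markov semigroup (QMS) is a $C_0$-semigroup $(\mathcal P_t)_{t\ge0}$ of completely positive unital maps on $\mathcal B(\mathcal H)$, with generator $\mathcal L$; $\dagger$ is the adjoint for the Hilbert–Schmidt inner product $\langle X,Y\rangle=\mathrm{Tr}(X^*Y)$. It is primitive if it has a unique invariant state $\sigma$ ($\mathcal P_t^\dagger(\sigma)=\sigma$ for all $t$) and $\sigma$ has full rank. The $\sigma$-KMS detailed balance condition means that $\mathcal L$ is self-adjoint for $\langle X,Y\rangle_{\sigma,1/2}=\mathrm{Tr}(\sigma^{1/2}X^*\sigma^{1/2}Y)$. For $r>0$, $\|X\|_{r,\sigma}=\mathrm{Tr}\big(|\sigma^{1/(2r)}X\sigma^{1/(2r)}|^r\big)^{1/r}$. For $Y\ge0$ put $\mathcal E_{2,\mathcal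 L}(Y)=-\langle Y,\mathcal L(Y)\rangle_{\sigma,1/2}$, $\mathrm{Var}_{q,\sigma}(Y)=\|Y\|_{2,\sigma}^2-\|Y\|_{q,\sigma}^2$, and, with $\Gamma_\sigma^{1/2}(Y)=\sigma^{1/4}Y\sigma^{1/4}$, $$\mathrm{Ent}_{2,\sigma}(Y)=\mathrm{Tr}\Big((\Gamma_\sigma^{1/2}(Y))^2\big(\log(\Gamma_\sigma^{1/2}(Y))^2-\log\sigma\big)\Big)-\|Y\|_{2,\sigma}^2\log\|Y\|_{2,\sigma}^2$$ (with $0\log 0=0$). (LSI) with constant $\beta$: $\beta\,\mathrm{Ent}_{2,\sigma}(Y)\le\mathcal E_{2,\mathcal L}(Y)$ for all $Y\ge0$. $(\mathrm{Bec}'_q)$ with constant $\beta_q$, $q\in(0,2)$: $\beta_q\,\mathrm{Var}_{q,\sigma}(Y)\le(2-q)\,\mathcal E_{2,\mathcal L}(Y)$ for all $Y\ge0$. *)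

(* Defs.v *)
From HB Require Import structures.
From mathcomp Require Export all_boot all_order all_algebra.
From mathcomp Require Export complex.
From mathcomp Require Export all_classical all_reals all_analysis.

Set Implicit Arguments.
Unset Strict Implicit.
Unset Printing Implicit Defensive.

Export Order.TTheory GRing.Theory Num.Theory numFieldNormedType.Exports.

#[export] Set Implicit Arguments.
Global Open Scope classical_set_scope.
Global Open Scope sesquilinear_scope.
Global Open Scope ring_scope.

(* The complex numbers R[i], seen as an abstract numClosedFieldType: it is on
   this type (and not on the concrete R[i]) that MathComp-Analysis infers the
   topology given by the modulus, hence the entrywise topology on matrices. *)
Definition Cx (R : realType) : numClosedFieldType := R[i].

Definition ReC (R : realType) (z : Cx R) : R := complex.Re (z : R[i]).
Definition RtoC (R : realType) (x : R) : Cx R := real_complex R x.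

(* A Hilbert space of dimension n is taken to be C^n with its canonical inner
   product, so that B(H) is the algebra of n x n complex matrices and
   A^t* is the adjoint of A. *)

Section Operators.
Context {R : realType}.
Local Notation C := (Cx R).

(* 0 <= z in C means that z is a nonnegative real, so that psdmx A entails
   that A is Hermitian. *)
Definition psdmx n (A : 'M[C]_n) : Prop :=
  forall v : 'cV[C]_n, 0 <= (v^t* *m A *m v) 0 0.

Definition density n (rho : 'M[C]_n) : Prop := psdmx rho /\ \tr rho = 1.

Definition full_rank n (A : 'M[C]_n) : Prop := \rank A = n.

(* Functional calculus f(A) of a Hermitian matrix A, through the spectral
   decomposition A = U^-1 diag(d) U with U unitary and d real. *)
Definition mxfun (f : R -> R) n (A : 'M[C]_n) : 'M[C]_n :=
  invmx (spectralmx A)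
  *m diag_mx (map_mx (fun z => RtoC (f (ReC z))) (spectral_diag A))
  *m spectralmx A.

(* A^s for A positive semidefinite; 0 `^ s = 0 as soon as s != 0. *)
Definition mxpow n (A : 'M[C]_n) (s : R) : 'M[C]_n := mxfun (fun x => x `^ s) A.

(* The library sets ln x = 0 for x <= 0, hence A log A is computed with the
   convention 0 log 0 = 0. *)
Definition mxln n (A : 'M[C]_n) : 'M[C]_n := mxfun (@ln R) A.

Definition mxabs n (A : 'M[C]_n) : 'M[C]_n := mxpow (A^t* *m A) 2^-1.

Definition hsdot n (X Y : 'M[C]_n) : C := \tr (X^t* *m Y).

(* The adjoint of Phi for hsdot, given by its matrix entries
   <E_ij, Phi^dagger(Y)> = <Phi(E_ij), Y>; see hsdot_adj. *)
Definition hsadj n (Phi : 'M[C]_n -> 'M[C]_n) (Y : 'M[C]_n) : 'M[C]_n :=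
  \matrix_(i, j) hsdot (Phi (delta_mx i j)) Y.

Definition positive_map m (Phi : 'M[C]_m -> 'M[C]_m) : Prop :=
  forall A, psdmx A -> psdmx (Phi A).

(* id_k (x) Phi, acting on M_k(M_n) = M_{n + ... + n} blockwise. *)
Definition ampliation n (k : nat) (Phi : 'M[C]_n -> 'M[C]_n)
    (A : 'M[C]_(\sum_(i < k) n)) : 'M[C]_(\sum_(i < k) n) :=
  \mxblock_(i < k, j < k)
    Phi (@submxblock C k k (fun=> n) (fun=> n) A i j).

Definition completely_positive n (Phi : 'M[C]_n -> 'M[C]_n) : Prop :=
  forall k : nat, positive_map (@ampliation n k Phi).

Record qms n (P : R -> {linear 'M[C]_n -> 'M[C]_n}) : Prop := QMS {
  qms_id : forall X, P 0 X = X ;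
  qms_semigroup : forall s t, 0 <= s -> 0 <= t ->
    forall X, P (s + t) X = P s (P t X) ;
  qms_C0 : forall X, P t X @[t --> 0^'+] --> X ;
  qms_cp : forall t, 0 <= t -> completely_positive (P t) ;
  qms_unital : forall t, 0 <= t -> P t 1%:M = 1%:M
}.

Definition generator n (P : R -> {linear 'M[C]_n -> 'M[C]_n})
    (L : {linear 'M[C]_n -> 'M[C]_n}) : Prop :=
  forall X, RtoC t^-1 *: (P t X - X) @[t --> 0^'+] --> L X.

Definition invariant_state n (P : R -> {linear 'M[C]_n -> 'M[C]_n})
    (rho : 'M[C]_n) : Prop :=
  density rho /\ forall t, 0 <= t -> hsadj (P t) rho = rho.

Definition primitive n (P : R -> {linear 'M[C]_n -> 'M[C]_n})
    (sigma : 'M[C]_n) : Prop :=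
  [/\ invariant_state P sigma,
      forall rho, invariant_state P rho -> rho = sigma &
      full_rank sigma].

Definition kmsdot n (sigma X Y : 'M[C]_n) : C :=
  \tr (mxpow sigma 2^-1 *m X^t* *m mxpow sigma 2^-1 *m Y).

Definition kms_detailed_balance n (sigma : 'M[C]_n)
    (L : {linear 'M[C]_n -> 'M[C]_n}) : Prop :=
  forall X Y, kmsdot sigma (L X) Y = kmsdot sigma X (L Y).

(* The traces below are real for the arguments of interest (Y positive
   semidefinite, L KMS-symmetric); ReC only changes their type to R. *)

Definition wnorm n (r : R) (sigma X : 'M[C]_n) : R :=
  let S := mxpow sigma (2 * r)^-1 in
  (ReC (\tr (mxpow (mxabs (S *m X *m S)) r))) `^ r^-1.

Definition dirichlet2 n (sigma : 'M[C]_n) (L : {linear 'M[C]_n -> 'M[C]_n})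
    (Y : 'M[C]_n) : R :=
  - ReC (kmsdot sigma Y (L Y)).

Definition Varq n (q : R) (sigma Y : 'M[C]_n) : R :=
  wnorm 2 sigma Y ^+ 2 - wnorm q sigma Y ^+ 2.

Definition Gamma_half n (sigma Y : 'M[C]_n) : 'M[C]_n :=
  mxpow sigma 4^-1 *m Y *m mxpow sigma 4^-1.

Definition Ent2 n (sigma Y : 'M[C]_n) : R :=
  let G2 := Gamma_half sigma Y *m Gamma_half sigma Y in
  ReC (\tr (G2 *m (mxln G2 - mxln sigma)))
  - wnorm 2 sigma Y ^+ 2 * ln (wnorm 2 sigma Y ^+ 2).

Definition LSI n (sigma : 'M[C]_n) (L : {linear 'M[C]_n -> 'M[C]_n})
    (beta : R) : Prop :=
  forall Y, psdmx Y -> beta * Ent2 sigma Y <= dirichlet2 sigma L Y.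

Definition dual_Beckner n (sigma : 'M[C]_n) (L : {linear 'M[C]_n -> 'M[C]_n})
    (q beta : R) : Prop :=
  forall Y, psdmx Y ->
    beta * Varq q sigma Y <= (2 - q) * dirichlet2 sigma L Y.

Lemma hsdotE n (X Y : 'M[C]_n) :
  hsdot X Y = \sum_i \sum_j (X i j)^* * Y i j.
Proof.
rewrite /hsdot /mxtrace exchange_big /=; apply: eq_bigr => j _.
by rewrite !mxE; apply: eq_bigr => i _; rewrite !mxE.
Qed.

Lemma hsdot_adj n (Phi : {linear 'M[C]_n -> 'M[C]_n}) (X Y : 'M[C]_n) :
  hsdot X (hsadj Phi Y) = hsdot (Phi X) Y.
Proof.
rewrite hsdotE {2}[X]matrix_sum_delta linear_sum {1}/hsdot /=.
rewrite raddf_sum raddf_sum mulmx_suml raddf_sum; apply: eq_bigr => i _.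
rewrite linear_sum raddf_sum raddf_sum mulmx_suml raddf_sum.
apply: eq_bigr => j _; rewrite linearZ /= linearZ /= map_mxZ -scalemxAl.
by rewrite linearZ /= mxE.
Qed.

End Operators.

(* Main.v *)
Require Import Defs.
From HB Require Import structures.
From mathcomp Require Import ring lra.

Set Implicit Arguments.
Unset Strict Implicit.
Unset Printing Implicit Defensive.

(** Let G = s^(1/4) Y s^(1/4), where s is the invariant state, and put
    v = 1/q - 1/2.  With T = G^(1/2) s^(v/2), the q-norm of Y weighted by s is
    the Schatten q-norm of T^t* T, hence also that of
      T T^t* = G^(1/2) s^v G^(1/2) =: N_v.
    Call it h(v); then h(0)^2 = Z := tr G^2, the variance is Z - h(v)^2, and
    2 - q = 2 q v.  The entropy Ent of Y is the trace of G^2 (ln G^2 - ln s)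
    minus Z ln Z, and the theorem amounts to comparing Z - h(v)^2 with
    2 v Ent.

    Part (b) follows from Z - h(v)^2 <= 2 v Ent for all v > 0
    ([var_le_ent]), which is implied by the exponential bound
    h(v) >= Z^(1/2) exp (- v Ent / Z) ([interp_norm_ge]).  For v < 1/2, that
    is for q > 1, Hoelder's inequality against G^(1 - 2 v) bounds h(v) below
    by a multiple of tr (s^v G^(2 - 2 v)), a sum of exponentials in v to which
    Jensen's inequality applies.  Every other v is reached by doublings,
    because h is log-convex along them: h(v)^2 <= h(0) h(2 v)
    ([interp_norm_double]).  To see this, let S = s^v G^(1/2); then
    N_(2v) = S^t* S and N_v = S^t* G^(1/2), so that N_v N_(2v)^-1 N_v <= G, and
    Hoelder's inequality with a negative exponent on N_(2v), which allows
    q < 1, gives the claim.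

    Part (a) needs the converse to first order: Z - h(v)^2 >= c v for small v
    as soon as c < 2 Ent ([var_ge_first_order]).  Hoelder's inequality against
    G^2 gives h(v)^2 <= tr (N_v^2 G^(-4 v)) Z^(2 v).  Writing s^v = 1 + E in the
    trace leaves, up to a remainder of second order, a sum over the spectra of
    G and s which is differentiable in v, with derivative - 2 Ent at 0.  This
    settles the case Ent > 0.  Otherwise Klein's inequality and its equality
    case force Ent = 0 and Y scalar ([klein]); then the Dirichlet form vanishes
    too, because the semigroup is unital.

    All trace inequalities are reduced to inequalities between real numbers by
      tr (f(A) g(B)) = sum_ij |<a_i, b_j>|^2 f(alpha_i) g(beta_j),
    where (alpha_i, a_i) and (beta_j, b_j) are the eigenpairs of A and B
    ([rtr_fcalM]). *)

(** * Convexity inequalities for finite sums *)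

Section Inequalities.
Context {R : realType}.

Lemma powR_young (t x y : R) : 0 < t < 1 -> 0 <= x -> 0 <= y ->
  x `^ t * y `^ (1 - t) <= t * x + (1 - t) * y.
Proof.
move=> /andP[t0 t1] x0 y0; have u0 : 0 < 1 - t by lra.
have := @conjugate_powR R (x `^ t) (y `^ (1 - t)) t^-1 (1 - t)^-1
  (powR_ge0 _ _) (powR_ge0 _ _).
rewrite !invr_gt0 !invrK => /(_ t0 u0).
rewrite -!powRrM !mulfV ?gt_eqF // !powRr1 // => /(_ ltac:(lra)).
by rewrite (mulrC x) (mulrC y).
Qed.

Lemma holder_sum (I : finType) (c x y : I -> R) (t : R) : 0 < t < 1 ->
  (forall i, 0 <= c i) -> (forall i, 0 <= x i) -> (forall i, 0 <= y i) ->
  \sum_i c i * (x i `^ t * y i `^ (1 - t)) <=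
  (\sum_i c i * x i) `^ t * (\sum_i c i * y i) `^ (1 - t).
Proof.
move=> t01 c0 x0 y0; have /andP[t0 t1] := t01; have u0 : 0 < 1 - t by lra.
set X := \sum_i c i * x i; set Y := \sum_i c i * y i.
have cx i : 0 <= c i * x i by rewrite mulr_ge0.
have cy i : 0 <= c i * y i by rewrite mulr_ge0.
have X0 : 0 <= X by apply: sumr_ge0.
have Y0 : 0 <= Y by apply: sumr_ge0.
have van (z : I -> R) r : 0 < r -> (forall i, 0 <= c i * z i) ->
    \sum_i c i * z i = 0 -> forall i, c i * z i `^ r = 0.
  move=> r0 cz /eqP; rewrite psumr_eq0 // => /allP h i.
  have := h i; rewrite mem_index_enum => /(_ isT) /=.
  by rewrite mulf_eq0 => /orP[]/eqP->; rewrite ?mul0r // powR0 ?mulr0 ?gt_eqF.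
have [X00|Xn0] := eqVneq X 0.
  rewrite big1 ?mulr_ge0 ?powR_ge0 // => i _.
  by rewrite mulrA (van x) // mul0r.
have [Y00|Yn0] := eqVneq Y 0.
  rewrite big1 ?mulr_ge0 ?powR_ge0 // => i _.
  by rewrite mulrCA (van y) // mulr0.
have Xp : 0 < X by rewrite lt0r Xn0.
have Yp : 0 < Y by rewrite lt0r Yn0.
have -> : X `^ t * Y `^ (1 - t) = \sum_i X `^ t * Y `^ (1 - t) *
    (t * (c i * x i / X) + (1 - t) * (c i * y i / Y)).
  rewrite -mulr_sumr big_split /= -!mulr_sumr -!mulr_suml -/X -/Y.
  by rewrite !divff //; ring.
apply: ler_sum => i _.
have := powR_young t01 (divr_ge0 (x0 i) X0) (divr_ge0 (y0 i) Y0).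
have XY0 := mulr_ge0 (powR_ge0 X t) (powR_ge0 Y (1 - t)).
move=> /(ler_wpM2l (mulr_ge0 (c0 i) XY0)).
have -> : x i `^ t = X `^ t * (x i / X) `^ t.
  by rewrite -powRM ?divr_ge0 // mulrC divfK.
have -> : y i `^ (1 - t) = Y `^ (1 - t) * (y i / Y) `^ (1 - t).
  by rewrite -powRM ?divr_ge0 // mulrC divfK.
rewrite -mulrA => h.
rewrite mulrACA; apply: (le_trans h).
by rewrite le_eqVlt; apply/orP; left; apply/eqP; ring.
Qed.

(** Every exponential lies above the tangent at the weighted mean. *)
Lemma jensen_expR (I : finType) (w l : I -> R) (v : R) :
  (forall i, 0 <= w i) -> 0 < \sum_i w i ->
  (\sum_i w i) * expR (v * (\sum_i w i * l i) / \sum_i w i) <=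
  \sum_i w i * expR (v * l i).
Proof.
move=> w0; set Z := \sum_i w i => Z0; set m := v * _ / Z.
apply: (@le_trans _ _ (\sum_i w i * (expR m * (1 + (v * l i - m))))).
  rewrite (eq_bigr (fun i => expR m * (1 - m) * w i + expR m * v * (w i * l i))).
    rewrite big_split /= -!mulr_sumr -/Z /m.
    have -> : forall a : R, a * (1 - v * (\sum_i w i * l i) / Z) * Z +
        a * v * (\sum_i w i * l i) = a * Z + a * v * (\sum_i w i * l i) * (1 - Z / Z).
      by move=> a; ring.
    by rewrite divff ?gt_eqF // subrr mulr0 addr0 mulrC.
  by move=> i _; ring.
apply: ler_sum => i _; apply: ler_wpM2l => //.
have -> : v * l i = m + (v * l i - m) by ring.
rewrite expRD; apply: ler_wpM2l; first exact: expR_ge0.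
by apply: le_trans (expR_ge1Dx _); rewrite le_eqVlt; apply/orP; left; apply/eqP; ring.
Qed.

End Inequalities.

(** * Functional calculus and traces *)

(** The matrix part is carried out over any algebraically closed field C with
    conjugation whose real elements are identified with R. *)
Record complexification (R : realType) (C : numClosedFieldType) :=
  Complexification {
  inj : {rmorphism R -> C} ;
  rep : {additive C -> R} ;
  injK : cancel inj rep ;
  rep_real : forall z, z \is Num.real -> inj (rep z) = z ;
  inj_ge0 : forall x, (0 <= inj x) = (0 <= x) ;
  rep_injM : forall x z, rep (inj x * z) = x * rep z }.

Section Scalars.
Context {R : realType} {C : numClosedFieldType} (K : complexification R C).

Lemma conj_inj (x : R) : (inj K x)^* = inj K x.
Proof.
apply: conj_Creal; rewrite realE inj_ge0.
by rewrite -oppr_ge0 -rmorphN inj_ge0 oppr_ge0 le_total.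
Qed.

Lemma rep_ge0 (z : C) : 0 <= z -> 0 <= rep K z.
Proof. by move=> z0; rewrite -(inj_ge0 K) rep_real // ger0_real. Qed.
End Scalars.

Section ComplexMatrices.
Context {C : numClosedFieldType}.

Lemma trmxCM m p q (X : 'M[C]_(m, p)) (Y : 'M[C]_(p, q)) :
  (X *m Y)^t* = Y^t* *m X^t*.
Proof. by rewrite trmx_mul map_mxM. Qed.

Lemma trmxCD m p (U V : 'M[C]_(m, p)) : (U + V)^t* = U^t* + V^t*.
Proof. by apply/matrixP => i j; rewrite !mxE rmorphD. Qed.

Lemma mxadE m p (U V : 'M[C]_(m, p)) i j : (U + V) i j = U i j + V i j.
Proof. by rewrite mxE. Qed.

Lemma mxascE m p (a : C) (U : 'M[C]_(m, p)) i j : (a *: U) i j = a * U i j.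
Proof. by rewrite mxE. Qed.

Lemma trmxCZ m p (a : C) (U : 'M[C]_(m, p)) : (a *: U)^t* = a^* *: U^t*.
Proof. by apply/matrixP => i j; rewrite !mxE rmorphM. Qed.

(** Polarization: the form of A - A^t* vanishes on the diagonal, and replacing
    u by 'i u separates the two halves of the polarized identity. *)
Lemma pos_form_herm n (A : 'M[C]_n) :
  (forall v : 'cV[C]_n, 0 <= (v^t* *m A *m v) 0 0) -> A^t* = A.
Proof.
move=> hA; apply/eqP; rewrite -subr_eq0; apply/eqP.
set D := _ - _.
have hD (v : 'cV[C]_n) : (v^t* *m D *m v) 0 0 = 0.
  have hv := conj_Creal (ger0_real (hA v)).
  rewrite /D mulmxBr mulmxBl mxE [X in _ + X]mxE.
  rewrite -[in X in _ - X]hv.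
  have -> : v^t* *m A^t* *m v = (v^t* *m A *m v)^t*.
    by rewrite !trmxCM trmxCK mulmxA.
  by rewrite !mxE subrr.
clearbody D.
have pol (u v : 'cV[C]_n) : (u^t* *m D *m v) 0 0 + (v^t* *m D *m u) 0 0 = 0.
  have := hD (u + v).
  have -> : (u + v)^t* *m D *m (u + v) =
      (u^t* *m D *m u + u^t* *m D *m v) + (v^t* *m D *m u + v^t* *m D *m v).
    by rewrite trmxCD mulmxDl mulmxDl mulmxDr mulmxDr.
  by rewrite 3!mxadE (hD u) (hD v) add0r addr0.
have pol2 (u v : 'cV[C]_n) : (u^t* *m D *m v) 0 0 = 0.
  have h1 := pol u v; have := pol ('i *: u) v.
  have -> : ('i *: u)^t* *m D *m v = - 'i *: (u^t* *m D *m v).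
    by rewrite trmxCZ conjCi -scalemxAl -scalemxAl.
  have -> : v^t* *m D *m ('i *: u) = 'i *: (v^t* *m D *m u).
    by rewrite -scalemxAr.
  rewrite 2!mxascE.
  rewrite mulNr addrC -mulrBr => /eqP.
  rewrite mulf_eq0 (negbTE (neq0Ci _)) /= subr_eq0 => /eqP h2.
  move: h1; rewrite h2 -mulr2n => /eqP.
  by rewrite mulrn_eq0 /= => /eqP.
apply/matrixP => i j; have := pol2 (delta_mx i 0) (delta_mx j 0).
rewrite -mulmxA -colE mxE (bigD1 i) //= big1 => [|k /negbTE ki].
  by rewrite !mxE !eqxx conjC1 mul1r addr0.
by rewrite !mxE ki conjC0 mul0r.
Qed.

End ComplexMatrices.

Section Calculus.
Context {R : realType} {C : numClosedFieldType}.
Context (K : complexification R C) {n : nat}.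
Implicit Types (A B T : 'M[C]_n) (f g : R -> R).

Definition fcal (f : R -> R) A : 'M[C]_n :=
  invmx (spectralmx A)
  *m diag_mx (map_mx (fun z => inj K (f (rep K z))) (spectral_diag A))
  *m spectralmx A.

Definition herm A := A^t* = A.

Definition ev A (i : 'I_n) : R := rep K (spectral_diag A 0 i).

(** The entry T i j can be nonzero only where a i = b j. *)
Lemma diag_intertwine f (a b : 'I_n -> R) T :
  diag_mx (\row_i inj K (a i)) *m T = T *m diag_mx (\row_i inj K (b i)) ->
  diag_mx (\row_i inj K (f (a i))) *m T = T *m diag_mx (\row_i inj K (f (b i))).
Proof.
move=> /matrixP h; apply/matrixP => i j; have := h i j.
rewrite !mul_diag_mx !mul_mx_diag !mxE.
have [->|tn0] := eqVneq (T i j) 0; first by rewrite !mulr0 !mul0r.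
rewrite mulrC => /(mulfI tn0) /(can_inj (injK K)) ->.
by rewrite mulrC.
Qed.

Lemma fcalE f A : fcal f A =
  (spectralmx A)^t* *m diag_mx (\row_i inj K (f (ev A i))) *m spectralmx A.
Proof.
rewrite /fcal invmx_unitary ?spectral_unitarymx //; congr (_ *m diag_mx _ *m _).
by apply/rowP => i; rewrite !mxE.
Qed.

Lemma spectralmxK A : spectralmx A *m (spectralmx A)^t* = 1%:M.
Proof. by apply/eqP; have := spectral_unitarymx A; rewrite qualifE. Qed.

Lemma spectralmxKt A : (spectralmx A)^t* *m spectralmx A = 1%:M.
Proof. exact/mulmx1C/spectralmxK. Qed.

Lemma fcal_id A : herm A -> fcal id A = A.
Proof.
move=> hA.
have hH : A \is hermsymmx.
  by apply/is_hermitianmxP; rewrite expr0 scale1r hA.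
have /orthomx_spectralP {2}-> := hermitian_normalmx hH.
rewrite fcalE invmx_unitary ?spectral_unitarymx //.
congr (_ *m diag_mx _ *m _).
apply/rowP => i; rewrite !mxE /ev rep_real //.
by have /mxOverP -> := hermitian_spectral_diag_real hH.
Qed.

(** In eigenbases of A and B this is [diag_intertwine].  It serves to carry
    functions from T^t* T over to T T^t*. *)
Lemma fcal_intertwine f A B T : herm A -> herm B ->
  A *m T = T *m B -> fcal f A *m T = T *m fcal f B.
Proof.
move=> hA hB; rewrite -{1}(fcal_id hA) -{1}(fcal_id hB) !fcalE => h.
pose S := spectralmx A *m T *m (spectralmx B)^t*.
have /(diag_intertwine f) : diag_mx (\row_i inj K (ev A i)) *m S =
    S *m diag_mx (\row_i inj K (ev B i)).
  rewrite /S; move: h => /(congr1 (fun M => spectralmx A *m M *m (spectralmx B)^t*)).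
  by rewrite !mulmxA spectralmxK mul1mx -!mulmxA spectralmxK mulmx1 !mulmxA.
move=> /(congr1 (fun M => (spectralmx A)^t* *m M *m spectralmx B)).
by rewrite /S !mulmxA spectralmxKt mul1mx -!mulmxA spectralmxKt mulmx1 !mulmxA.
Qed.

Lemma fcalM f g A : fcal f A *m fcal g A = fcal (fun x => f x * g x) A.
Proof.
rewrite !fcalE -!mulmxA (mulmxA (spectralmx A)) spectralmxK mul1mx.
congr (_ *m _); rewrite !mulmxA; congr (_ *m _).
rewrite mulmx_diag; congr diag_mx; apply/rowP => i; rewrite !mxE.
by rewrite rmorphM.
Qed.

Lemma fcal1 A : fcal (fun=> 1) A = 1%:M.
Proof.
rewrite fcalE; set D := diag_mx _; suff -> : D = 1%:M by rewrite mulmx1 spectralmxKt.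
by apply/matrixP => i j; rewrite !mxE rmorph1.
Qed.

Lemma eq_fcal f g A : (forall i, f (ev A i) = g (ev A i)) -> fcal f A = fcal g A.
Proof.
move=> fg; rewrite !fcalE; congr (_ *m diag_mx _ *m _).
by apply/rowP => i; rewrite !mxE fg.
Qed.

Lemma fcal_herm f A : herm (fcal f A).
Proof.
rewrite /herm !fcalE !trmxCM trmxCK mulmxA; congr (_ *m _ *m _).
apply/matrixP => i j; rewrite !mxE eq_sym.
by case: eqVneq => [->|_]; rewrite ?mulr1n ?mulr0n ?conj_inj // conjC0.
Qed.

Lemma fcalB f g A : fcal (fun x => f x - g x) A = fcal f A - fcal g A.
Proof.
rewrite !fcalE -mulmxBl -mulmxBr -raddfB; congr (_ *m diag_mx _ *m _).
by apply/rowP => i; rewrite !mxE rmorphB.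
Qed.

(** The eigenbasis of A diagonalizes f(A) as well, but need not be the one that
    defines g(f(A)); [diag_intertwine] compares the two. *)
Lemma fcal_comp f g A : fcal g (fcal f A) = fcal (fun x => g (f x)) A.
Proof.
set F := fcal f A; have hF : herm F := fcal_herm _ _.
pose V := spectralmx A *m (spectralmx F)^t*.
have /(diag_intertwine g) : diag_mx (\row_i inj K (f (ev A i))) *m V =
    V *m diag_mx (\row_i inj K (ev F i)).
  have := fcal_id hF; rewrite {2}/F !fcalE.
  move=> /(congr1 (fun M => spectralmx A *m M *m (spectralmx F)^t*)).
  rewrite !mulmxA spectralmxK mul1mx -!mulmxA spectralmxK mulmx1 !mulmxA => h.
  exact: esym.
move=> /(congr1 (fun M => (spectralmx A)^t* *m M *m spectralmx F)).
rewrite /V !mulmxA spectralmxKt mul1mx -!mulmxA spectralmxKt mulmx1 !mulmxA.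
by rewrite !fcalE => ->.
Qed.

(** The squared overlap of the i-th eigenvector of A with the j-th one of B. *)
Definition ovl A B i j : R :=
  rep K (`|(spectralmx A *m (spectralmx B)^t*) i j| ^+ 2).

Lemma ovl_ge0 A B i j : 0 <= ovl A B i j.
Proof. by apply: rep_ge0; rewrite exprn_ge0. Qed.

Definition rtr A : R := rep K (\tr A).

Lemma rtrB A B : rtr (A - B) = rtr A - rtr B.
Proof. by rewrite /rtr !raddfB. Qed.

Lemma rtrD A B : rtr (A + B) = rtr A + rtr B.
Proof. by rewrite /rtr !raddfD. Qed.

Lemma rtrC A B : rtr (A *m B) = rtr (B *m A).
Proof. by rewrite /rtr mxtrace_mulC. Qed.

(** Both sides compute the trace of a S b S^t*, where a and b are the diagonal
    forms of f(A) and g(B), and S is the matrix of change of eigenbasis. *)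
Lemma rtr_fcalM f g A B : rtr (fcal f A *m fcal g B) =
  \sum_(p : 'I_n * 'I_n) ovl A B p.1 p.2 * (f (ev A p.1) * g (ev B p.2)).
Proof.
transitivity (\sum_i \sum_j ovl A B i j * (f (ev A i) * g (ev B j))); last first.
  by rewrite pair_bigA.
rewrite !fcalE; set U := spectralmx A; set V := spectralmx B.
set a := diag_mx _; set b := diag_mx _; pose S := U *m V^t*.
have -> : rtr (U^t* *m a *m U *m (V^t* *m b *m V)) =
    rtr (a *m S *m (b *m S^t*)).
  rewrite -!mulmxA rtrC /S trmxCM trmxCK !mulmxA -!mulmxA.
  by [].
rewrite /rtr /mxtrace raddf_sum; apply: eq_bigr => i _ /=.
rewrite mxE raddf_sum; apply: eq_bigr => j _ /=.
rewrite mul_diag_mx mul_diag_mx !mxE -/S.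
rewrite mulrACA -rmorphM rep_injM /ovl -/U -/V -/S normCK.
by rewrite !mxE; ring.
Qed.

Implicit Types X : 'M[C]_n.

Definition psd A := forall v : 'cV[C]_n, 0 <= (v^t* *m A *m v) 0 0.

Lemma psd_congr A T : psd A -> psd (T^t* *m A *m T).
Proof.
move=> hA v; have := hA (T *m v).
by rewrite trmxCM !mulmxA.
Qed.

Lemma gram_entry X i : (X^t* *m X) i i = \sum_k `|X k i| ^+ 2.
Proof.
rewrite mxE; apply: eq_bigr => k _.
by rewrite !mxE mulrC -normCK.
Qed.

Lemma psd_gram X : psd (X^t* *m X).
Proof.
move=> v.
have -> : v^t* *m (X^t* *m X) *m v = (X *m v)^t* *m (X *m v).
  by rewrite trmxCM !mulmxA.
rewrite mxE sumr_ge0 // => k _.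
by rewrite !mxE mulrC -normCK exprn_ge0.
Qed.

Lemma psd_diag_ge0 A i : psd A -> 0 <= A i i.
Proof.
move=> /(_ (delta_mx i 0)).
rewrite -mulmxA -colE mxE (bigD1 i) //= big1 => [|k /negbTE ki].
  by rewrite !mxE !eqxx conjC1 mul1r addr0.
by rewrite !mxE ki conjC0 mul0r.
Qed.

Lemma psd_herm A : psd A -> herm A.
Proof. exact: pos_form_herm. Qed.

Lemma spectralE A : herm A ->
  spectralmx A *m A *m (spectralmx A)^t* = diag_mx (\row_i inj K (ev A i)).
Proof.
move=> hA; rewrite -{2}(fcal_id hA) fcalE !mulmxA spectralmxK mul1mx.
by rewrite -mulmxA spectralmxK mulmx1.
Qed.

Lemma psd_ev A i : psd A -> 0 <= ev A i.
Proof.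
move=> hA; have hH := psd_herm hA.
have := psd_diag_ge0 i (psd_congr ((spectralmx A)^t*) hA).
by rewrite trmxCK spectralE // !mxE eqxx mulr1n inj_ge0.
Qed.

Lemma fcal_sqrt f A : (forall i, 0 <= f (ev A i)) ->
  fcal f A = fcal (fun x => Num.sqrt (f x)) A *m fcal (fun x => Num.sqrt (f x)) A.
Proof.
by move=> h; rewrite fcalM; apply: eq_fcal => i; rewrite -expr2 sqr_sqrtr.
Qed.

Lemma rtr_gram X : rtr (X^t* *m X) = \sum_i \sum_k rep K (`|X k i| ^+ 2).
Proof.
rewrite /rtr /mxtrace raddf_sum; apply: eq_bigr => i _ /=.
by rewrite gram_entry raddf_sum.
Qed.

Lemma rtr_gram_ge0 X : 0 <= rtr (X^t* *m X).
Proof.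
rewrite rtr_gram; apply: sumr_ge0 => i _; apply: sumr_ge0 => k _.
by apply: rep_ge0; rewrite exprn_ge0.
Qed.

Lemma gram_eq0 X : X^t* *m X = 0 -> X = 0.
Proof.
move=> h; apply/matrixP => k i; rewrite mxE.
have : (X^t* *m X) i i = 0 by rewrite h mxE.
rewrite gram_entry => /eqP; rewrite psumr_eq0 => [|j _]; last exact: exprn_ge0.
move=> /allP /(_ k); rewrite mem_index_enum => /(_ isT) /=.
by rewrite expf_eq0 /= normr_eq0 => /eqP.
Qed.

Lemma rtr_fcal_gram f A X : (forall i, 0 <= f (ev A i)) ->
  0 <= rtr (fcal f A *m (X^t* *m X)).
Proof.
move=> h; rewrite fcal_sqrt //; set S := fcal _ _.
have -> : rtr (S *m S *m (X^t* *m X)) = rtr ((X *m S)^t* *m (X *m S)).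
  by rewrite trmxCM fcal_herm -/S -mulmxA rtrC !mulmxA.
exact: rtr_gram_ge0.
Qed.

Lemma full_rank_ev A i : psd A -> \rank A = n -> 0 < ev A i.
Proof.
move=> hA rA; rewrite lt0r psd_ev // andbT; apply/eqP => e0.
have uA : A \in unitmx by rewrite -row_free_unit /row_free rA.
have := spectralE (psd_herm hA) => /(congr1 determinant).
rewrite det_diag !det_mulmx (bigD1 i) //= !mxE e0 rmorph0 mul0r => /eqP.
apply/negP; rewrite -unitfE -!det_mulmx -unitmxE !unitmx_mul uA andbT.
by rewrite !unitarymx_unit ?trmxC_unitary ?spectral_unitarymx.
Qed.

(** T T^t* and T^t* T have the same spectrum.  Splitting off one factor of the
    argument turns [fcal_intertwine] into an instance of cyclicity of the
    trace. *)
Lemma rtr_iso f g T : (forall x, 0 <= x -> f x = x * g x) ->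
  rtr (fcal f (T *m T^t*)) = rtr (fcal f (T^t* *m T)).
Proof.
move=> hf; have pT := psd_gram T.
have pT' : psd (T *m T^t*) by have := psd_gram (T^t*); rewrite trmxCK.
have e A : psd A -> fcal f A = A *m fcal g A.
  move=> hA; rewrite -{2}(fcal_id (psd_herm hA)) fcalM.
  by apply: eq_fcal => i /=; rewrite hf // psd_ev.
have it : T *m T^t* *m T = T *m (T^t* *m T) by rewrite mulmxA.
have := fcal_intertwine g (psd_herm pT') (psd_herm pT) it => h.
by rewrite !e // rtrC mulmxA h rtrC mulmxA.
Qed.

End Calculus.

Section Traces.
Context {R : realType} {C : numClosedFieldType}.
Context (K : complexification R C) {n : nat}.
Implicit Types (A B T : 'M[C]_n) (f g h k : R -> R).
Local Notation fc := (fcal K).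
Local Notation tr := (rtr K).

Lemma rtr_fcalE f A : tr (fc f A) = \sum_i f (ev K A i).
Proof.
rewrite fcalE rtrC mulmxA spectralmxK mul1mx /rtr /mxtrace raddf_sum.
by apply: eq_bigr => i _; rewrite !mxE eqxx mulr1n injK.
Qed.

(** A nonnegative sum vanishes termwise: the eigenvectors that f(A) and g(B)
    select are pairwise orthogonal. *)
Lemma rtr_support f g A B :
  (forall i, 0 <= f (ev K A i)) -> (forall i, 0 <= g (ev K B i)) ->
  tr (fc f A *m fc g B) = 0 ->
  forall i j, ovl K A B i j != 0 -> f (ev K A i) * g (ev K B j) = 0.
Proof.
move=> f0 g0; rewrite rtr_fcalM => /eqP; rewrite psumr_eq0; last first.
  by move=> p _; rewrite !mulr_ge0 ?ovl_ge0.
move=> /allP H i j on0; have := H (i, j); rewrite mem_index_enum => /(_ isT).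
by rewrite /= mulf_eq0 (negbTE on0) => /eqP.
Qed.

(** The overlap weights form a measure on pairs of eigenvalues, and Hoelder's
    inequality for this measure applies; pairs of weight zero are exempted from
    the pointwise comparison so that A or B may be singular. *)
Lemma rtr_holder h k f1 g1 f2 g2 A B (t : R) : 0 < t < 1 ->
  (forall i j, 0 <= f1 (ev K A i) * g1 (ev K B j)) ->
  (forall i j, 0 <= f2 (ev K A i) * g2 (ev K B j)) ->
  (forall i j, ovl K A B i j != 0 -> h (ev K A i) * k (ev K B j) <=
    (f1 (ev K A i) * g1 (ev K B j)) `^ t *
    (f2 (ev K A i) * g2 (ev K B j)) `^ (1 - t)) ->
  tr (fc h A *m fc k B) <=
  tr (fc f1 A *m fc g1 B) `^ t * tr (fc f2 A *m fc g2 B) `^ (1 - t).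
Proof.
move=> t01 h1 h2 H; rewrite !rtr_fcalM.
apply: le_trans (holder_sum t01 _ _ _); last 3 first.
- by move=> p; exact: ovl_ge0.
- by move=> p; exact: h1.
- by move=> p; exact: h2.
apply: ler_sum => p _.
have [->|on0] := eqVneq (ovl K A B p.1 p.2) 0; first by rewrite !mul0r.
by rewrite ler_wpM2l ?ovl_ge0 ?H.
Qed.

Definition fpow (r : R) A := fc (fun x => x `^ r) A.

Lemma fpow_herm r A : (fpow r A)^t* = fpow r A.
Proof. exact: fcal_herm. Qed.

Lemma fpowD A a b : (forall i, 0 < ev K A i) -> fpow a A *m fpow b A = fpow (a + b) A.
Proof.
move=> h; rewrite fcalM; apply: eq_fcal => i.
by rewrite powRD //; apply/implyP => _; rewrite gt_eqF.
Qed.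

Lemma fcal0 A : fc (fun=> 0) A = 0.
Proof.
have <- : fc (fun=> 1 - 1) A = fc (fun=> 0) A by apply: eq_fcal => i; rewrite subrr.
by rewrite fcalB subrr.
Qed.

Lemma fpow1 A : psd A -> fpow 1 A = A.
Proof.
move=> pA; rewrite -[RHS](fcal_id K (psd_herm pA)); apply: eq_fcal => i /=.
by rewrite powRr1 ?(psd_ev K).
Qed.

Lemma fpow_half A : psd A -> fpow 2^-1 A *m fpow 2^-1 A = A.
Proof.
move=> pA; rewrite -[RHS](fpow1 pA) fcalM; apply: eq_fcal => i.
by rewrite -powRD; [congr (_ `^ _); lra | apply/implyP => /eqP; lra].
Qed.

End Traces.

(** * Log-convexity of the weighted norms *)
Section PseudoInverse.
Context {R : realType} {C : numClosedFieldType}.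
Context (K : complexification R C) {n : nat}.
Implicit Types (T g Q X N : 'M[C]_n).
Local Notation tr := (rtr K).

(** The power -1 is the pseudo-inverse, as 0 `^ (-1) = 0.  Hence
    T (T^t* T)^-1 T^t* is the orthogonal projection onto the range of T, and
    with N = T^t* g Hermitian the product N (T^t* T)^-1 N is at most g g. *)
Lemma pinv_gram_le T g Q : g^t* = g -> Q^t* = Q ->
  (T^t* *m g)^t* = T^t* *m g ->
  tr (fpow K (-1) (T^t* *m T) *m ((T^t* *m g) *m (Q *m Q) *m (T^t* *m g))) <=
  tr (g *m g *m (Q *m Q)).
Proof.
move=> hg hQ hN; pose W := T *m T^t*.
have pW : psd W by have := psd_gram (T^t*); rewrite trmxCK.
have it : T *m fpow K (-1) (T^t* *m T) = fpow K (-1) W *m T.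
  apply/esym/fcal_intertwine; [exact: psd_herm| exact/psd_herm/psd_gram |].
  by rewrite /W mulmxA.
have -> : tr (g *m g *m (Q *m Q)) = tr ((Q *m g)^t* *m (Q *m g)).
  by rewrite trmxCM hg hQ -mulmxA rtrC !mulmxA.
set Y := Q *m g.
have -> : tr (fpow K (-1) (T^t* *m T) *m
    ((T^t* *m g) *m (Q *m Q) *m (T^t* *m g))) =
    tr (fpow K (-1) W *m W *m (Y^t* *m Y)).
  rewrite -{2}hN trmxCM trmxCK hg.
  have -> : fpow K (-1) (T^t* *m T) *m (T^t* *m g *m (Q *m Q) *m (g *m T)) =
      fpow K (-1) (T^t* *m T) *m (T^t* *m (Y^t* *m Y)) *m T.
    by rewrite /Y trmxCM hg hQ !mulmxA.
  by rewrite rtrC mulmxA it /W !mulmxA.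
rewrite -subr_ge0 -rtrB -{1}[Y^t* *m Y]mul1mx -mulmxBl.
rewrite -(fcal1 K W) -{3}(fcal_id K (psd_herm pW)) fcalM -fcalB.
apply: rtr_fcal_gram => i /=.
have w0 : 0 <= ev K W i by exact: psd_ev.
have [->|w1] := eqVneq (ev K W i) 0; first by rewrite mulr0 subr0.
by rewrite powR_inv1 // mulVf // subrr.
Qed.

(** The kernel of T^t* T is that of T, on which N = g T vanishes: an eigenvector
    of N for a nonzero eigenvalue is orthogonal to it. *)
Lemma gram_support X N T g i j : X = T^t* *m T -> N = g *m T -> psd N ->
  ovl K X N i j != 0 -> ev K N j != 0 -> 0 < ev K X i.
Proof.
move=> XE NE pN; pose P := fcal K (fun x => (x == 0)%:R) X.
have pX : psd X by rewrite XE; exact: psd_gram.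
have XP0 : X *m P = 0.
  rewrite -{1}(fcal_id K (psd_herm pX)) fcalM -(fcal0 K X).
  by apply: eq_fcal => k /=; have [->|] := eqVneq; rewrite ?mul0r ?mulr0.
have TP0 : T *m P = 0.
  apply: gram_eq0; rewrite trmxCM [P^t*]fcal_herm mulmxA -(mulmxA P).
  by rewrite -XE -mulmxA XP0 mulmx0.
have H : tr (P *m fcal K id N) = 0.
  rewrite (fcal_id K (psd_herm pN)) NE rtrC -mulmxA TP0 mulmx0.
  by rewrite /rtr mxtrace0 raddf0.
move=> on0 n0; rewrite lt0r (psd_ev K) // andbT.
apply/negP => /eqP x0; move: n0.
have f0 (m : 'I_n) : 0 <= (ev K X m == 0)%:R :> R by exact: ler0n.
have n0 (m : 'I_n) : 0 <= ev K N m by exact: psd_ev.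
have := rtr_support (f := fun x => (x == 0)%:R) (g := id) f0 n0 H on0.
by rewrite x0 eqxx mul1r => ->; rewrite eqxx.
Qed.

End PseudoInverse.

(** Exponent bookkeeping for [interp_norm_double].  With p = 1/(1/2 + v) and
    t = 1/2 + 2 v, the weight theta = t / (1 + t) is the one for which
    y^p = (x^(1/t))^theta (x^-1 y^(2 + p/2))^(1 - theta). *)
Section DoubleExponents.
Context {R : realType}.
Implicit Types (v x y Q W Z : R).

Definition double_theta v := (2^-1 + 2 * v) / (1 + (2^-1 + 2 * v)).

Lemma double_theta1 v : 0 < v -> 1 - double_theta v = (1 + (2^-1 + 2 * v))^-1.
Proof. by move=> v0; rewrite /double_theta; field; apply/eqP; lra. Qed.

Lemma double_exponents_range v : 0 < v ->
  [/\ 0 < (2^-1 + v)^-1, 0 < double_theta v < 1 & 0 <= 1 - double_theta v].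
Proof.
move=> v0; have h : 0 < (1 + (2^-1 + 2 * v))^-1 by rewrite invr_gt0; lra.
have := double_theta1 v0; split; last by lra.
- by rewrite invr_gt0; lra.
- by apply/andP; split; [apply: mulr_gt0 => //; lra | lra].
Qed.

Lemma double_pointwise v x y : 0 < v -> 0 <= y -> (y != 0 -> 0 < x) ->
  y `^ (2^-1 + v)^-1 <= (x `^ (2^-1 + 2 * v)^-1) `^ double_theta v *
    (x `^ (-1) * y `^ (2 + (2^-1 + v)^-1 / 2)) `^ (1 - double_theta v).
Proof.
move=> v0 y0 hx; have [p0 _ _] := double_exponents_range v0.
have [->|yn0] := eqVneq y 0.
  by rewrite powR0 ?gt_eqF // mulr_ge0 ?powR_ge0.
have x0 := hx yn0.
rewrite powRM ?powR_ge0 // -!powRrM mulrA -powRD; last first.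
  by rewrite (gt_eqF x0) implybT.
have -> : (2^-1 + 2 * v)^-1 * double_theta v + -1 * (1 - double_theta v) = 0.
  rewrite double_theta1 // /double_theta; field.
  by apply/andP; split; apply/eqP; lra.
rewrite powRr0 mul1r double_theta1 //.
have -> // : (2 + (2^-1 + v)^-1 / 2) * (1 + (2^-1 + 2 * v))^-1 = (2^-1 + v)^-1.
by field; do ?[apply/andP; split]; apply/eqP; lra.
Qed.

Lemma double_exponents v Q W Z : 0 < v -> 0 <= Q -> 
  Q <= W `^ double_theta v * (Z `^ 2^-1 * Q `^ 2^-1) `^ (1 - double_theta v) ->
  (Q `^ (2^-1 + v)) ^+ 2 <= Z `^ 2^-1 * W `^ (2^-1 + 2 * v).
Proof.
move=> v0 Q0 H.
have [->|Qn0] := eqVneq Q 0.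
  by rewrite powR0 ?expr0n ?mulr_ge0 ?powR_ge0 //; apply/eqP; lra.
have q0 : 0 < Q `^ 2^-1 by rewrite powR_gt0 // lt0r Qn0.
have e3 : Q `^ 2^-1 * (Q `^ (2^-1 + v)) ^+ 2 = Q `^ (1 + (2^-1 + 2 * v)).
  rewrite -powR_mulrn ?powR_ge0 // -powRrM -powRD ?Qn0 ?implybT //.
  by congr (_ `^ _); lra.
rewrite -(ler_pM2l q0) e3 mulrCA [X in _ <= X]mulrA.
have -> : Z `^ 2^-1 * Q `^ 2^-1 * W `^ (2^-1 + 2 * v) =
    (W `^ double_theta v * (Z `^ 2^-1 * Q `^ 2^-1) `^ (1 - double_theta v))
      `^ (1 + (2^-1 + 2 * v)).
  rewrite powRM ?powR_ge0 // -!powRrM double_theta1 // mulVf.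
    rewrite powRr1 ?mulr_ge0 ?powR_ge0 // mulrC; congr (_ `^ _ * _).
    by rewrite /double_theta; field; apply/eqP; lra.
  by apply/eqP; lra.
apply: ge0_ler_powR => //; rewrite ?nnegrE ?mulr_ge0 ?powR_ge0 //; lra.
Qed.

End DoubleExponents.

Section Beckner.
Context {R : realType} {C : numClosedFieldType}.
Context (K : complexification R C) {n : nat}.
Implicit Types (A B T : 'M[C]_n) (f g h k : R -> R).
Local Notation fc := (fcal K).
Local Notation tr := (rtr K).
Local Notation pw := (fpow K).
Variables (s G : 'M[C]_n).
Hypotheses (s0 : forall i, 0 < ev K s i) (pG : psd G).

(** The matrix N_v, whose Schatten norm of exponent 1/(1/2 + v) interpolates
    between the weighted norms; at v = 0 it is G. *)
Definition interp (v : R) := pw 2^-1 G *m pw v s *m pw 2^-1 G.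
Definition interp_tr (v : R) := tr (pw (2^-1 + v)^-1 (interp v)).
Definition interp_norm (v : R) := interp_tr v `^ (2^-1 + v).
Definition sqnorm := tr (G *m G).

(** A square root of N_(2v) which, unlike the positive one, is also a factor of
    N_v; this is what relates N_v to N_(2v). *)
Definition interp_root (v : R) := pw v s *m pw 2^-1 G.

Lemma interp_doubleE v : interp (2 * v) = (interp_root v)^t* *m interp_root v.
Proof.
have -> : 2 * v = v + v by ring.
by rewrite /interp_root trmxCM !fpow_herm /interp -fpowD // !mulmxA.
Qed.

Lemma interp_psd v : psd (interp v).
Proof.
have -> : v = 2 * (v / 2) by field.
by rewrite interp_doubleE; exact: psd_gram.
Qed.

Lemma interpE_l v : interp v = (interp_root v)^t* *m pw 2^-1 G.
Proof. by rewrite trmxCM !fpow_herm. Qed.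

Lemma interpE_r v : interp v = pw 2^-1 G *m interp_root v.
Proof. by rewrite /interp_root mulmxA. Qed.

Lemma interp_tr_ge0 v : 0 <= interp_tr v.
Proof. by rewrite /interp_tr rtr_fcalE sumr_ge0 // => i _; exact: powR_ge0. Qed.

Lemma sqnormE : sqnorm = tr (fc (fun x => x ^+ 2) G).
Proof.
by rewrite /sqnorm -{1 2}(fcal_id K (psd_herm pG)) fcalM; congr tr.
Qed.

Lemma sqnorm_ge0 : 0 <= sqnorm.
Proof. by rewrite sqnormE rtr_fcalE sumr_ge0 // => i _; exact: sqr_ge0. Qed.

Let evN v i : 0 <= ev K (interp v) i. Proof. exact/psd_ev/interp_psd. Qed.

Lemma interp_support v i j : ovl K (interp (2 * v)) (interp v) i j != 0 ->
  ev K (interp v) j != 0 -> 0 < ev K (interp (2 * v)) i.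
Proof. exact: gram_support (interp_doubleE v) (interpE_r v) (interp_psd v). Qed.

Lemma rtr_pinv_le v : 0 < v ->
  tr (pw (-1) (interp (2 * v)) *m pw (2 + (2^-1 + v)^-1 / 2) (interp v)) <=
  tr (G *m pw ((2^-1 + v)^-1 / 2) (interp v)).
Proof.
move=> v0; have p0 : 0 < (2^-1 + v)^-1 by rewrite invr_gt0; lra.
set r := (2^-1 + v)^-1 / 2; have r0 : 0 < r by rewrite divr_gt0.
set X := interp (2 * v); set N := interp v; set g := pw 2^-1 G; set P := pw r N.
have pN : psd N := interp_psd v.
have hN : fc id N = N by apply: fcal_id; exact: psd_herm.
have -> : pw (2 + r) N = N *m P *m N.
  rewrite -{2 3}hN !fcalM; apply: eq_fcal => i /=.
  have [->|n0] := eqVneq (ev K N i) 0.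
    by rewrite mulr0 powR0 // gt_eqF // addr_gt0.
  rewrite powRD ?n0 ?implybT // mulrAC -expr2 powR_mulrn //.
  exact: evN.
have -> : P = pw (r / 2) N *m pw (r / 2) N.
  rewrite fcalM; apply: eq_fcal => i.
  rewrite -powRD; first by congr (_ `^ _); field.
  by apply/implyP => /eqP; lra.
rewrite /X interp_doubleE /N {1 4}interpE_l -{3}(fpow_half K pG).
by apply: pinv_gram_le; rewrite ?fpow_herm // -interpE_l psd_herm.
Qed.

Lemma rtr_cauchy v : 0 < v ->
  tr (G *m pw ((2^-1 + v)^-1 / 2) (interp v)) <=
  sqnorm `^ 2^-1 * interp_tr v `^ 2^-1.
Proof.
move=> v0; have p0 : 0 < (2^-1 + v)^-1 by rewrite invr_gt0; lra.
have g0 i := psd_ev K i pG.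
have e1 : sqnorm = tr (fc (fun x => x ^+ 2) G *m fc (fun=> 1) (interp v)).
  by rewrite fcal1 mulmx1 sqnormE.
have e2 : interp_tr v = tr (fc (fun=> 1) G *m pw (2^-1 + v)^-1 (interp v)).
  by rewrite fcal1 mul1mx.
rewrite e1 e2 -{1}(fcal_id K (psd_herm pG)).
rewrite [X in _ * _ `^ X](_ : 2^-1 = 1 - 2^-1 :> R); last lra.
apply: rtr_holder.
- by apply/andP; split; lra.
- by move=> i j; rewrite mulr1 sqr_ge0.
- by move=> i j; rewrite mul1r powR_ge0.
- move=> i j _ /=; rewrite mulr1 mul1r -powR_mulrn // -!powRrM mulfV ?pnatr_eq0 //.
  rewrite powRr1 // le_eqVlt; apply/orP; left; apply/eqP.
  by congr (_ * _ `^ _); lra.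
Qed.

(** Midpoint log-convexity between 0 and 2 v.  Hoelder's inequality bounds
    tr N^p, where N = N_v, through powers of tr X^(1/t) and tr (X^-1 N^(2 + p/2)),
    where X = N_(2v); since N X^-1 N <= G the latter is at most tr (G N^(p/2)),
    and Cauchy-Schwarz brings tr N^p back. *)
Lemma interp_norm_double v : 0 < v ->
  interp_norm v ^+ 2 <= sqnorm `^ 2^-1 * interp_norm (2 * v).
Proof.
move=> v0; apply: double_exponents => //; [exact: interp_tr_ge0|].
have [p0 th01 t10] := double_exponents_range v0.
have e0 : interp_tr v =
    tr (fc (fun=> 1) (interp (2 * v)) *m pw (2^-1 + v)^-1 (interp v)).
  by rewrite fcal1 mul1mx.
have e1 : interp_tr (2 * v) =
    tr (pw (2^-1 + 2 * v)^-1 (interp (2 * v)) *m fc (fun=> 1) (interp v)).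
  by rewrite fcal1 mulmx1.
apply: le_trans (_ : interp_tr (2 * v) `^ double_theta v *
  tr (pw (-1) (interp (2 * v)) *m pw (2 + (2^-1 + v)^-1 / 2) (interp v))
    `^ (1 - double_theta v) <= _); last first.
  rewrite ler_wpM2l ?powR_ge0 //; apply: ge0_ler_powR.
  - exact: t10.
  - rewrite nnegrE rtr_fcalM sumr_ge0 // => q _.
    by rewrite !mulr_ge0 ?ovl_ge0 ?powR_ge0.
  - by rewrite nnegrE mulr_ge0 ?powR_ge0.
  - exact: le_trans (rtr_pinv_le v0) (rtr_cauchy v0).
rewrite {1}e0 e1; apply: rtr_holder => //.
- by move=> i j; rewrite mulr1 powR_ge0.
- by move=> i j; rewrite mulr_ge0 ?powR_ge0.
- move=> i j on0; rewrite mul1r mulr1; apply: double_pointwise => //.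
  exact: interp_support.
Qed.

End Beckner.

(** * The variance is at most the entropy *)
Section LowerScalars.
Context {R : realType}.
Implicit Types (v x y Z E h : R).

Lemma lower_pointwise v x y : 0 < v < 2^-1 -> 0 <= x -> 0 <= y ->
  x * y `^ (1 - 2 * v) <=
  (x `^ (2^-1 + v)^-1) `^ (2^-1 + v) * (y ^+ 2) `^ (1 - (2^-1 + v)).
Proof.
move=> /andP[v0 v1] x0 y0; rewrite -powR_mulrn // -!powRrM mulVf; last first.
  by apply/eqP; lra.
rewrite powRr1 // le_eqVlt; apply/orP; left; apply/eqP.
by congr (_ * _ `^ _); lra.
Qed.

Lemma powR_sqr_expR v x y : 0 <= x -> 0 < y -> v < 1 ->
  x `^ (2 - 2 * v) * y `^ v = x ^+ 2 * expR (v * (ln y - 2 * ln x)).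
Proof.
move=> x0 y0 v1; have [->|xn0] := eqVneq x 0.
  by rewrite powR0 ?expr0n ?mul0r //; apply/eqP; lra.
have xp : 0 < x by rewrite lt0r xn0.
rewrite {2}/powR (gt_eqF y0) powRD ?xn0 ?implybT // powR_mulrn // -mulrA.
by congr (_ * _); rewrite /powR (negbTE xn0) -expRD; congr expR; ring.
Qed.

Lemma lower_combine v Z E h : 0 < Z ->
  Z * expR (v * (- E) / Z) <= h * Z `^ (1 - (2^-1 + v)) ->
  Z `^ 2^-1 * expR (- (v * (E - Z * ln Z) / Z)) <= h.
Proof.
move=> Z0; have c0 : 0 < Z `^ (1 - (2^-1 + v)) by exact: powR_gt0.
move=> H; rewrite -(ler_pM2r c0); apply: le_trans H.
rewrite le_eqVlt; apply/orP; left; apply/eqP.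
transitivity (expR (ln Z) * expR (v * - E / Z)); last by rewrite lnK ?posrE.
rewrite /powR (gt_eqF Z0) -!expRD; congr expR.
by field; rewrite gt_eqF.
Qed.

Lemma lower_step v Z E h2 h : 0 < Z ->
  Z `^ 2^-1 * expR (- (v * E / Z)) <= h ->
  h ^+ 2 <= Z `^ 2^-1 * h2 ->
  Z `^ 2^-1 * expR (- (2 * v * E / Z)) <= h2.
Proof.
move=> Z0 H1 H2; have z0 : 0 < Z `^ 2^-1 by rewrite powR_gt0.
have h0 : 0 <= Z `^ 2^-1 * expR (- (v * E / Z)).
  by rewrite mulr_ge0 ?expR_ge0 ?powR_ge0.
rewrite -(ler_pM2l z0); apply: le_trans H2; apply: le_trans (_ : _ <=
  (Z `^ 2^-1 * expR (- (v * E / Z))) ^+ 2) _; last first.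
  by rewrite ler_pXn2r ?nnegrE // (le_trans h0).
rewrite le_eqVlt; apply/orP; left; apply/eqP.
have -> : - (2 * v * E / Z) = - (v * E / Z) + - (v * E / Z) by ring.
by rewrite expRD; ring.
Qed.

Lemma lower_var v Z E h : 0 < Z ->
  Z `^ 2^-1 * expR (- (v * E / Z)) <= h -> Z - h ^+ 2 <= 2 * v * E.
Proof.
move=> Z0 H; have h0 : 0 <= Z `^ 2^-1 * expR (- (v * E / Z)).
  by rewrite mulr_ge0 ?expR_ge0 ?powR_ge0.
have : (Z `^ 2^-1 * expR (- (v * E / Z))) ^+ 2 <= h ^+ 2.
  by rewrite ler_pXn2r ?nnegrE // (le_trans h0).
have -> : (Z `^ 2^-1 * expR (- (v * E / Z))) ^+ 2 =
    Z * expR (- (v * E / Z) + - (v * E / Z)).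
  rewrite exprMn expRD -expr2 -[X in X * _]powR_mulrn ?powR_ge0 //.
  by rewrite -powRrM mulVf ?pnatr_eq0 // powRr1 // ltW.
move=> H2.
have := expR_ge1Dx (- (v * E / Z) + - (v * E / Z)) => /(ler_wpM2l (ltW Z0)) H3.
have : Z * (1 + (- (v * E / Z) + - (v * E / Z))) = Z - 2 * v * E.
  by field; rewrite gt_eqF.
lra.
Qed.

End LowerScalars.

Section Lower.
Context {R : realType} {C : numClosedFieldType}.
Context (K : complexification R C) {n : nat}.
Local Notation fc := (fcal K).
Local Notation tr := (rtr K).
Local Notation pw := (fpow K).
Variables (s G : 'M[C]_n).
Hypotheses (s0 : forall i, 0 < ev K s i) (pG : psd G).
Local Notation interp := (interp K s G).
Local Notation interp_tr := (interp_tr K s G).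
Local Notation interp_norm := (interp_norm K s G).
Local Notation sqnorm := (sqnorm K G).

Lemma rtr_sandwich (g A B : 'M[C]_n) :
  tr (g *m A *m g *m B) = tr (g *m B *m g *m A).
Proof. by rewrite -mulmxA rtrC !mulmxA. Qed.

(** The trace of G^2 (ln G^2 - ln s), by [rtr_fcalM]. *)
Definition relent := \sum_(p : 'I_n * 'I_n) ovl K G s p.1 p.2 *
  (ev K G p.1 ^+ 2 * (2 * ln (ev K G p.1) - ln (ev K s p.2))).

Definition ent := relent - sqnorm * ln sqnorm.

Lemma sqnorm_sum : sqnorm =
  \sum_(p : 'I_n * 'I_n) ovl K G s p.1 p.2 * ev K G p.1 ^+ 2.
Proof.
rewrite sqnormE // -[fc _ G]mulmx1 -(fcal1 K s) rtr_fcalM.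
by apply: eq_bigr => p _; rewrite mulr1.
Qed.

(** The exponent of G is chosen so that the dual norm only involves tr G^2; for
    q > 1 the two Hoelder exponents q and q/(q - 1) are positive, which is the
    condition v < 1/2. *)
Lemma interp_norm_holder v : 0 < v < 2^-1 ->
  tr (interp v *m pw (1 - 2 * v) G) <= interp_norm v * sqnorm `^ (1 - (2^-1 + v)).
Proof.
move=> v01; have g0 i := psd_ev K i pG.
have n0 i := psd_ev K i (interp_psd G s0 v).
have e1 : sqnorm = tr (fc (fun=> 1) (interp v) *m fc (fun x => x ^+ 2) G).
  by rewrite fcal1 mul1mx sqnormE.
have e2 : interp_tr v = tr (pw (2^-1 + v)^-1 (interp v) *m fc (fun=> 1) G).
  by rewrite fcal1 mulmx1.
rewrite /interp_norm e1 e2 -{1}(fcal_id K (psd_herm (interp_psd G s0 v))).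
apply: rtr_holder.
- by case/andP: v01 => a b; apply/andP; split; lra.
- by move=> i j; rewrite mulr1 powR_ge0.
- by move=> i j; rewrite mul1r sqr_ge0.
- by move=> i j _ /=; rewrite mulr1 mul1r; exact: lower_pointwise.
Qed.

Lemma rtr_interp_pow v : 0 < v < 2^-1 -> tr (interp v *m pw (1 - 2 * v) G) =
  \sum_(p : 'I_n * 'I_n) ovl K G s p.1 p.2 * ev K G p.1 ^+ 2 *
    expR (v * (ln (ev K s p.2) - 2 * ln (ev K G p.1))).
Proof.
move=> /andP[v0 v1].
have -> : tr (interp v *m pw (1 - 2 * v) G) = tr (pw (2 - 2 * v) G *m pw v s).
  have -> : pw (2 - 2 * v) G = pw 2^-1 G *m pw (1 - 2 * v) G *m pw 2^-1 G.
    rewrite !fcalM; apply: eq_fcal => i.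
    rewrite -!powRD; [|by apply/implyP => /eqP; lra..].
    by congr (_ `^ _); lra.
  exact: rtr_sandwich.
rewrite rtr_fcalM; apply: eq_bigr => p _.
by rewrite powR_sqr_expR ?mulrA //; [exact: psd_ev | lra].
Qed.

Lemma interp_norm_ge_small v : 0 < v < 2^-1 -> 0 < sqnorm ->
  sqnorm `^ 2^-1 * expR (- (v * ent / sqnorm)) <= interp_norm v.
Proof.
move=> v01 Z0; apply: lower_combine => //.
apply: le_trans (interp_norm_holder v01); rewrite rtr_interp_pow //.
have w0 (p : 'I_n * 'I_n) : 0 <= ovl K G s p.1 p.2 * ev K G p.1 ^+ 2.
  by rewrite mulr_ge0 ?ovl_ge0 ?sqr_ge0.
pose l (p : 'I_n * 'I_n) := ln (ev K s p.2) - 2 * ln (ev K G p.1).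
have eE : - relent = \sum_p ovl K G s p.1 p.2 * ev K G p.1 ^+ 2 * l p.
  by rewrite /relent -sumrN; apply: eq_bigr => p _; rewrite /l; ring.
rewrite eE; move: Z0; rewrite sqnorm_sum => Z0.
exact: (jensen_expR l v w0 Z0).
Qed.

(** The bound is stable under [interp_norm_double], as its right-hand side is
    log-affine in v; induction on k covers v < 2^k / 2. *)
Lemma interp_norm_ge v : 0 < v -> 0 < sqnorm ->
  sqnorm `^ 2^-1 * expR (- (v * ent / sqnorm)) <= interp_norm v.
Proof.
move=> v0 Z0.
suff H k : forall v, 0 < v -> v < 2 ^+ k / 2 ->
    sqnorm `^ 2^-1 * expR (- (v * ent / sqnorm)) <= interp_norm v.
  have := archi_boundP (_ : 0 <= 2 * v) => /(_ ltac:(lra)).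
  set k := Num.bound _ => hk; apply: (H k) => //.
  have : k%:R < 2 ^+ k :> R by rewrite -natrX ltr_nat ltn_expl.
  lra.
elim: k => [|k IH] {v v0} v v0 vk.
  by apply: interp_norm_ge_small => //; rewrite v0; move: vk; rewrite expr0; lra.
have v20 : 0 < v / 2 by lra.
have -> : v = 2 * (v / 2) by field.
apply: (lower_step Z0 (IH _ v20 _)); last exact: interp_norm_double.
by move: vk; rewrite exprS; lra.
Qed.

Lemma ent_sqnorm0 : sqnorm = 0 -> ent = 0.
Proof.
move=> Z0; rewrite /ent Z0 mul0r subr0 /relent big1 // => p _.
have := Z0; rewrite sqnorm_sum => /eqP; rewrite psumr_eq0; last first.
  by move=> q _; rewrite mulr_ge0 ?ovl_ge0 ?sqr_ge0.
move=> /allP /(_ p); rewrite mem_index_enum => /(_ isT) /= /eqP.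
by rewrite mulrA => ->; rewrite mul0r.
Qed.

Lemma var_le_ent v : 0 < v -> sqnorm - interp_norm v ^+ 2 <= 2 * v * ent.
Proof.
move=> v0; have := sqnorm_ge0 K pG; rewrite le_eqVlt => /orP[/eqP Z0|Z0].
  by rewrite ent_sqnorm0 -?Z0 // mulr0 sub0r oppr_le0 sqr_ge0.
exact: lower_var Z0 (interp_norm_ge v0 Z0).
Qed.

End Lower.

(** * First-order lower bound on the variance *)
Section FirstOrder.
Context {R : realType}.
Implicit Types (f g : R -> R) (c d e v x y l : R).

Lemma first_order_upper f d c : is_derive (0 : R) 1 f d -> d < c ->
  exists2 e : R, 0 < e & forall v, 0 < v < e -> f v < f 0 + c * v.
Proof.
move=> [df <-] dc.
have h : h^-1 *: (f (h *: 1 + 0) - f 0) @[h --> (0 : R)^'] --> 'D_1 f 0.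
  exact: df.
have : \forall h \near (0 : R)^', h^-1 *: (f (h *: 1 + 0) - f 0) < c.
  exact: cvgr_lt h _ dc.
rewrite near_withinE => /nbhs_ballP[e /= e0 H].
exists e => // v /andP[v0 ve].
have : ball (0 : R) e v by rewrite /ball /= sub0r normrN gtr0_norm.
move=> /H /(_ (lt0r_neq0 v0)); rewrite /GRing.scale /= mulr1 addr0.
by rewrite mulrC ltr_pdivrMr // => ?; lra.
Qed.

Lemma is_derive_expM (a x : R) :
  is_derive x 1 (fun v => expR (v * a)) (expR (x * a) * a).
Proof.
have D : is_derive x (1 : R) (fun v : R => v * a) a.
  have -> : (fun v : R => v * a) = a \*: (@id R).
    by apply/funext => v; rewrite /= mulrC.
  by apply: is_derive_eq (is_deriveZ _ _) _; rewrite /GRing.scale /= mulr1.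
exact: (is_derive1_comp (f := expR) (g := fun v => v * a)).
Qed.

Lemma is_derive_bigsum (I : finType) (h : I -> R -> R) (dh : I -> R) (x : R) :
  (forall i, is_derive x 1 (h i) (dh i)) ->
  is_derive x 1 (fun v => \sum_i h i v) (\sum_i dh i).
Proof.
move=> D; have -> : (fun v => \sum_i h i v) = \sum_i h i.
  by apply/funext => v; rewrite fct_sumE.
by elim/big_ind2 : _ => // [|] *; [exact: is_derive_cst|exact: is_deriveD].
Qed.

(** The contribution of an eigenvalue x of G and an eigenvalue y of s to the
    bound on tr (s^v G s^v F), F = G^(1 - 4 v), given by [rtr_conj_le]; l stands
    for tr G.  The second summand is of order v^2. *)
Definition upper_term (x y l v : R) :=
  (2 * expR (v * ln y) - 1) * (x ^+ 2 * expR (v * (- 4 * ln x))) +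
  l * (expR (v * ln y) - 1) ^+ 2 * (x * expR (v * (- 4 * ln x))).

Lemma upper_term0 x y l : upper_term x y l 0 = x ^+ 2.
Proof. by rewrite /upper_term !mul0r !expR0; ring. Qed.

Lemma is_derive_upper_term (x y l : R) :
  is_derive (0 : R) 1 (upper_term x y l)
    (x ^+ 2 * (2 * ln y - 4 * ln x)).
Proof.
have De a : is_derive (0 : R) 1 (fun v => expR (v * a)) a.
  by apply: is_derive_eq (is_derive_expM _ _) _; rewrite mul0r expR0 mul1r.
have Dc c : is_derive (0 : R) 1 (fun=> c : R) 0 by exact: is_derive_cst.
have DZ c f d : is_derive (0 : R) 1 f d ->
    is_derive (0 : R) 1 (fun v => c * f v) (c * d).
  by move=> D; exact: (is_deriveZ c D).
have DD f g d e : is_derive (0 : R) 1 f d -> is_derive (0 : R) 1 g e ->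
    is_derive (0 : R) 1 (fun v => f v + g v) (d + e).
  by move=> D E; exact: (is_deriveD D E).
have DM f g d e : is_derive (0 : R) 1 f d -> is_derive (0 : R) 1 g e ->
    is_derive (0 : R) 1 (fun v => f v * g v) (f 0 * e + g 0 * d).
  by move=> D E; exact: (is_deriveM D E).
have D1 := DD _ _ _ _ (De (ln y)) (Dc (- 1)).
have D2 := DD _ _ _ _ (DZ 2 _ _ (De (ln y))) (Dc (- 1)).
have D3 := DZ (x ^+ 2) _ _ (De (- 4 * ln x)).
have D4 := DZ x _ _ (De (- 4 * ln x)).
have D5 := DM _ _ _ _ (DZ l _ _ (DM _ _ _ _ D1 D1)) D4.
apply: is_derive_eq (DD _ _ _ _ (DM _ _ _ _ D2 D3) D5) _.
by rewrite !mul0r !expR0; ring.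
Qed.

End FirstOrder.

Section UpperTrace.
Context {R : realType} {C : numClosedFieldType}.
Context (K : complexification R C) {n : nat}.
Implicit Types (A B E F G S : 'M[C]_n) (f a : R -> R).
Local Notation fc := (fcal K).
Local Notation tr := (rtr K).

(** With a(s) = 1 + E and F = f(G), which commutes with G, the left-hand side
    expands into tr (G F (1 + 2 E)) + tr (E G E F).  The last term is bounded
    using G <= tr G: it is not a sum over pairs of eigenvalues, but its bound
    tr G * tr (F E E) is. *)
Lemma rtr_conj_le G s f a : psd G -> (forall i, 0 <= f (ev K G i)) ->
  tr (fc a s *m G *m fc a s *m fc f G) <=
  tr (fc (fun x => x * f x) G *m fc (fun x => 2 * a x - 1) s) +
  tr G * tr (fc f G *m fc (fun x => (a x - 1) ^+ 2) s).
Proof.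
move=> pG f0; have gE := fcal_id K (psd_herm pG).
have -> : fc (fun x => x * f x) G = G *m fc f G by rewrite -{2}gE fcalM.
have -> : fc (fun x => 2 * a x - 1) s = fc a s + (fc a s - 1%:M).
  rewrite -(fcal1 K s) -opprB -!fcalB; apply: eq_fcal => i; ring.
have cFG : fc f G *m G = G *m fc f G.
  rewrite -{2 3}gE !fcalM; apply: eq_fcal => i; exact: mulrC.
have SE : fc a s = 1%:M + (fc a s - 1%:M) by rewrite addrC subrK.
have sqE : fc (fun x => (a x - 1) ^+ 2) s =
    (fc a s - 1%:M) *m (fc a s - 1%:M).
  by rewrite -(fcal1 K s) -fcalB fcalM.
have hE : (fc a s - 1%:M)^t* = fc a s - 1%:M.
  by rewrite -(fcal1 K s) -fcalB; exact: fcal_herm.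
rewrite sqE; move: (fc a s - 1%:M) SE hE {sqE} => E -> hE.
have -> : tr ((1%:M + E) *m G *m (1%:M + E) *m fc f G) =
    tr (G *m fc f G *m (1%:M + E + E)) + tr (E *m G *m E *m fc f G).
  have t1 : tr (G *m E *m fc f G) = tr (G *m fc f G *m E).
    by rewrite rtrC mulmxA cFG.
  have t2 : tr (E *m G *m fc f G) = tr (G *m fc f G *m E).
    by rewrite -mulmxA rtrC.
  rewrite !(mulmxDl, mulmxDr, mul1mx, mulmx1) !rtrD t1 t2.
  by ring.
rewrite lerD2l.
have H : fc f G = fc (fun x => Num.sqrt (f x)) G *m fc (fun x => Num.sqrt (f x)) G.
  exact: fcal_sqrt.
have h := fcal_herm K (fun x => Num.sqrt (f x)) G; rewrite /herm in h.
move: (fc (fun x => Num.sqrt (f x)) G) H h => H -> hH.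
have -> : tr (E *m G *m E *m (H *m H)) = tr (G *m ((H *m E)^t* *m (H *m E))).
  by rewrite trmxCM hE hH -!mulmxA rtrC !mulmxA.
have -> : tr (H *m H *m (E *m E)) = tr ((H *m E)^t* *m (H *m E)).
  by rewrite trmxCM hE hH mulmxA rtrC !mulmxA.
move: (H *m E) => Y.
have -> : tr G * tr (Y^t* *m Y) = tr (fc (fun=> tr G) G *m (Y^t* *m Y)).
  have <- : inj K (tr G) *: 1%:M = fc (fun=> tr G) G.
    rewrite -(fcal1 K G) !fcalE scalemxAl scalemxAr; congr (_ *m _ *m _).
    by apply/matrixP => i j; rewrite !mxE rmorph1 mulrnAr mulr1.
  by rewrite -scalemxAl mul1mx /rtr mxtraceZ rep_injM.
rewrite -{1}gE -subr_ge0 -rtrB -mulmxBl -fcalB.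
apply: rtr_fcal_gram => i; rewrite /= subr_ge0.
rewrite -{2}gE rtr_fcalE (bigD1 i) //= lerDl sumr_ge0 // => j _.
exact: psd_ev.
Qed.

End UpperTrace.

Section Upper.
Context {R : realType} {C : numClosedFieldType}.
Context (K : complexification R C) {n : nat}.
Local Notation fc := (fcal K).
Local Notation tr := (rtr K).
Local Notation pw := (fpow K).
Variables (s G : 'M[C]_n).
Hypotheses (s0 : forall i, 0 < ev K s i) (pG : psd G).
Local Notation interp := (interp K s G).
Local Notation interp_tr := (interp_tr K s G).
Local Notation interp_norm := (interp_norm K s G).
Local Notation sqnorm := (sqnorm K G).
Local Notation ent := (ent K s G).

Lemma upper_pointwise (v x y : R) : 0 < v -> 0 <= x -> 0 <= y ->
  (y != 0 -> 0 < x) ->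
  y `^ (2^-1 + v)^-1 <= ((x ^+ 2) `^ (- (2 * v)) * y ^+ 2) `^ (1 + 2 * v)^-1 *
    (x ^+ 2) `^ (1 - (1 + 2 * v)^-1).
Proof.
move=> v0 x0 y0 hx; have p0 : 0 < (2^-1 + v)^-1 by rewrite invr_gt0; lra.
have [->|yn0] := eqVneq y 0.
  by rewrite powR0 ?gt_eqF // mulr_ge0 ?powR_ge0.
have xp := hx yn0.
rewrite powRM ?powR_ge0 ?sqr_ge0 // -powRrM mulrAC -powRD; last first.
  by rewrite (gt_eqF (exprn_gt0 _ xp)) implybT.
have -> : - (2 * v) * (1 + 2 * v)^-1 + (1 - (1 + 2 * v)^-1) = 0.
  by field; apply/eqP; lra.
rewrite powRr0 mul1r -powR_mulrn // -powRrM le_eqVlt; apply/orP; left.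
by apply/eqP; congr (_ `^ _); field; do ?[apply/andP; split]; apply/eqP; lra.
Qed.

(** Hoelder's inequality against G^2, the optimal choice at v = 0.  The
    eigenvectors of N_v for nonzero eigenvalues are orthogonal to the kernel of
    G, so negative powers of G are harmless. *)
Lemma interp_tr_le v : 0 < v ->
  interp_tr v <= tr (fc (fun x => (x ^+ 2) `^ (- (2 * v))) G *m
    (interp v *m interp v)) `^ (1 + 2 * v)^-1 * sqnorm `^ (1 - (1 + 2 * v)^-1).
Proof.
move=> v0; have g0 i := psd_ev K i pG.
have pN := interp_psd G s0 v; have n0 i := psd_ev K i pN.
have -> : interp v *m interp v = fc (fun x => x ^+ 2) (interp v).
  by rewrite -{1 2}(fcal_id K (psd_herm pN)) fcalM; apply: eq_fcal.
have e1 : sqnorm = tr (fc (fun x => x ^+ 2) G *m fc (fun=> 1) (interp v)).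
  by rewrite fcal1 mulmx1 sqnormE.
have e2 : interp_tr v = tr (fc (fun=> 1) G *m pw (2^-1 + v)^-1 (interp v)).
  by rewrite fcal1 mul1mx.
rewrite e1 e2; apply: rtr_holder.
- by rewrite invr_gt0 invf_lt1; lra.
- by move=> i j; rewrite mulr_ge0 ?powR_ge0 ?sqr_ge0.
- by move=> i j; rewrite mulr1 sqr_ge0.
- move=> i j on0; rewrite mul1r mulr1; apply: upper_pointwise => //.
  apply: (gram_support (T := pw 2^-1 G) (g := pw 2^-1 G *m pw v s) _ _ pN on0).
    by rewrite fpow_herm fpow_half.
  by [].
Qed.

Lemma interp_norm_sqr_le v : 0 < v -> interp_norm v ^+ 2 <=
  tr (fc (fun x => (x ^+ 2) `^ (- (2 * v))) G *m (interp v *m interp v)) *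
  sqnorm `^ (2 * v).
Proof.
move=> v0; have := interp_tr_le v0; set U := tr _ => H.
have U0 : 0 <= U.
  have e : interp v = (interp v)^t* by rewrite psd_herm //; exact: interp_psd.
  by rewrite /U {1}e; apply: rtr_fcal_gram => i; exact: powR_ge0.
have -> : interp_norm v ^+ 2 = interp_tr v `^ (1 + 2 * v).
  rewrite /interp_norm -powR_mulrn ?powR_ge0 // -powRrM; congr (_ `^ _); lra.
have -> : U * sqnorm `^ (2 * v) =
    (U `^ (1 + 2 * v)^-1 * sqnorm `^ (1 - (1 + 2 * v)^-1)) `^ (1 + 2 * v).
  rewrite powRM ?powR_ge0 // -!powRrM mulVf ?powRr1 //; last by apply/eqP; lra.
  by congr (_ * _ `^ _); field; apply/eqP; lra.
apply: ge0_ler_powR => //; rewrite ?nnegrE ?interp_tr_ge0 ?mulr_ge0 ?powR_ge0 //; lra.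
Qed.

Lemma rtr_interp_sq (g S F A : 'M[C]_n) : g *m g = A ->
  tr (F *m (g *m S *m g *m (g *m S *m g))) = tr (S *m A *m S *m (g *m F *m g)).
Proof.
move=> <-; have -> : F *m (g *m S *m g *m (g *m S *m g)) =
  F *m g *m (S *m (g *m g) *m S *m g) by rewrite !mulmxA.
by rewrite rtrC !mulmxA.
Qed.

(** A differentiable majorant of h(v)^2 which agrees with it at v = 0 to first
    order. *)
Definition interp_bound v := (\sum_(p : 'I_n * 'I_n) ovl K G s p.1 p.2 *
   upper_term (ev K G p.1) (ev K s p.2) (tr G) v) * expR (v * (2 * ln sqnorm)).

Lemma sqr_powR_expR (v x : R) : 0 <= x ->
  x * (x ^+ 2) `^ (- (2 * v)) = x * expR (v * (- 4 * ln x)).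
Proof.
move=> x0; have [->|xn0] := eqVneq x 0; first by rewrite !mul0r.
rewrite -powR_mulrn // -powRrM /powR (negbTE xn0); congr (_ * expR _).
by ring.
Qed.

Lemma interp_norm_le_bound v : 0 < v -> 0 < sqnorm ->
  interp_norm v ^+ 2 <= interp_bound v.
Proof.
move=> v0 Z0; apply: le_trans (interp_norm_sqr_le v0) _.
have -> : sqnorm `^ (2 * v) = expR (v * (2 * ln sqnorm)).
  by rewrite /powR gt_eqF //; congr expR; ring.
apply: ler_wpM2r; first exact: expR_ge0.
rewrite /interp (rtr_interp_sq _ _ (fpow_half K pG)).
have g0 i := psd_ev K i pG.
have -> : pw 2^-1 G *m fc (fun x => (x ^+ 2) `^ (- (2 * v))) G *m pw 2^-1 G =
    fc (fun x => x * expR (v * (- 4 * ln x))) G.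
  rewrite !fcalM; apply: eq_fcal => i.
  rewrite mulrAC -powRD; last by apply/implyP => /eqP; lra.
  have -> : 2^-1 + 2^-1 = 1 :> R by lra.
  by rewrite powRr1 // sqr_powR_expR.
apply: le_trans (rtr_conj_le _ _ pG _) _.
  by move=> i; rewrite mulr_ge0 ?expR_ge0.
rewrite !rtr_fcalM mulr_sumr -big_split /= le_eqVlt; apply/orP; left.
apply/eqP; apply: eq_bigr => p _; rewrite /upper_term.
rewrite /powR (gt_eqF (s0 _)); ring.
Qed.

(** The majorant equals Z at v = 0 and has derivative - 2 Ent there. *)
Lemma var_ge_first_order c : 0 < sqnorm -> c < 2 * ent ->
  exists2 e : R, 0 < e & forall v, 0 < v < e -> c * v <= sqnorm - interp_norm v ^+ 2.
Proof.
move=> Z0 ce.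
have D1 : is_derive (0 : R) 1 (fun v => \sum_(p : 'I_n * 'I_n) ovl K G s p.1 p.2 *
    upper_term (ev K G p.1) (ev K s p.2) (tr G) v)
    (\sum_(p : 'I_n * 'I_n) ovl K G s p.1 p.2 *
    (ev K G p.1 ^+ 2 * (2 * ln (ev K s p.2) - 4 * ln (ev K G p.1)))).
  apply: is_derive_bigsum => p.
  exact: (is_deriveZ _ (is_derive_upper_term _ _ _)).
have D2 := is_derive_expM (2 * ln sqnorm) 0.
have U0 : interp_bound 0 = sqnorm.
  rewrite /interp_bound mul0r expR0 mulr1 (sqnorm_sum _ s pG); apply: eq_bigr => p _.
  by rewrite upper_term0.
have D : is_derive (0 : R) 1 interp_bound (- (2 * ent)).
  apply: is_derive_eq (is_deriveM D1 D2) _.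
  rewrite /GRing.scale /= mul0r expR0 !mul1r.
  have -> : \sum_(p : 'I_n * 'I_n) ovl K G s p.1 p.2 *
    upper_term (ev K G p.1) (ev K s p.2) (tr G) 0 = sqnorm.
    by move: U0; rewrite /interp_bound mul0r expR0 mulr1.
  have -> : \sum_(p : 'I_n * 'I_n) ovl K G s p.1 p.2 *
    (ev K G p.1 ^+ 2 * (2 * ln (ev K s p.2) - 4 * ln (ev K G p.1))) =
    - (2 * relent K s G).
    rewrite /relent mulr_sumr -sumrN; apply: eq_bigr => p _; ring.
  by rewrite /ent; ring.
have ce' : - (2 * ent) < - c by rewrite ltrN2.
have [e e0 H] := first_order_upper D ce'.
exists e => // v ve; have /andP[v0 _] := ve.
have := H v ve; have := interp_norm_le_bound v0 Z0; rewrite U0; lra.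
Qed.

End Upper.

(** * Klein's inequality and its equality case *)
Section KleinScalar.
Context {R : realType}.

(** With t = ln (z y / x^2) this is 1 + t <= expR t, an equality only at t = 0;
    x = 0 is never an equality case since z y > 0. *)
Lemma klein_scalar (x y z : R) : 0 <= x -> 0 < y -> 0 < z ->
  0 <= x ^+ 2 * (2 * ln x - ln y - ln z) - x ^+ 2 + z * y ?= iff
    (x == Num.sqrt z * y `^ 2^-1).
Proof.
move=> x0 y0 z0.
have r0 : 0 < Num.sqrt z * y `^ 2^-1 by rewrite mulr_gt0 ?sqrtr_gt0 ?powR_gt0.
have [->|xn0] := eqVneq x 0.
  rewrite expr0n mul0r subr0 add0r; split; first by rewrite mulr_ge0 ?ltW.
  by rewrite !lt_eqF // mulr_gt0.
have xp : 0 < x by rewrite lt0r xn0.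
set t := ln y + ln z - 2 * ln x.
have x20 : 0 < x ^+ 2 by rewrite exprn_gt0.
have et : z * y = x ^+ 2 * expR t.
  have x2e : x ^+ 2 = expR (2 * ln x).
    by rewrite -[in LHS](lnK (x := x)) ?posrE // -expRM_natl.
  rewrite x2e /t -expRD.
  by rewrite [2 * _ + _]addrC subrK expRD !lnK ?posrE // mulrC.
have -> : x ^+ 2 * (2 * ln x - ln y - ln z) - x ^+ 2 + z * y =
    x ^+ 2 * (expR t - (1 + t)) by rewrite et /t; ring.
have xE : (x == Num.sqrt z * y `^ 2^-1) = (t == 0).
  rewrite -(eqrXn2 (n := 2)) // ?ltW // exprMn sqr_sqrtr ?ltW //.
  have -> : (y `^ 2^-1) ^+ 2 = y.
    rewrite -powR_mulrn ?powR_ge0 // -powRrM mulVf ?pnatr_eq0 // powRr1 //.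
    exact: ltW.
  rewrite et -{1}[x ^+ 2]mulr1 (inj_eq (mulfI (lt0r_neq0 x20))) -expR0.
  by rewrite (inj_eq (@expR_inj R)) eq_sym.
rewrite xE; split; first by rewrite (mulr_ge0 (ltW x20)) // subr_ge0 expR_ge1Dx.
rewrite eq_sym mulf_eq0 (gt_eqF x20) /= subr_eq0.
have [->|tn0] := eqVneq t 0; first by rewrite expR0 addr0 eqxx.
by rewrite gt_eqF // expR_gt1Dx.
Qed.

End KleinScalar.

Section Klein.
Context {R : realType} {C : numClosedFieldType}.
Context (K : complexification R C) {n : nat}.
Local Notation fc := (fcal K).
Local Notation tr := (rtr K).
Local Notation pw := (fpow K).
Variables (s G : 'M[C]_n).
Hypotheses (ps : psd s) (s0 : forall i, 0 < ev K s i) (pG : psd G).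
Local Notation sqnorm := (sqnorm K G).
Local Notation ent := (ent K s G).

Lemma rtr_gram_eq0 (X : 'M[C]_n) : tr (X^t* *m X) = 0 -> X = 0.
Proof.
have nn i k : 0 <= rep K (`|X k i| ^+ 2) by apply: rep_ge0; rewrite exprn_ge0.
rewrite rtr_gram => /eqP; rewrite psumr_eq0 => [/allP h|i _]; last exact: sumr_ge0.
apply/matrixP => k i; rewrite mxE.
have := h i; rewrite mem_index_enum => /(_ isT); rewrite psumr_eq0 //.
move=> /allP /(_ k); rewrite mem_index_enum => /(_ isT) /eqP h0.
have : `|X k i| ^+ 2 = 0.
  by rewrite -[LHS](rep_real K) ?h0 ?rmorph0 // ger0_real // exprn_ge0.
by move=> /eqP; rewrite expf_eq0 /= normr_eq0 => /eqP.
Qed.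

Lemma rtr_fcalr f : tr (fc f s) =
  \sum_(p : 'I_n * 'I_n) ovl K G s p.1 p.2 * f (ev K s p.2).
Proof.
rewrite -[fc f s]mul1mx -(fcal1 K G) rtr_fcalM.
by apply: eq_bigr => p _; rewrite mul1r.
Qed.

(** The terms linear in G^2 and s inserted by [klein_scalar] cancel in the sum,
    because s has trace 1.  In the equality case every overlapping pair of
    eigenvalues satisfies x = sqrt (Z y), so that the Hilbert-Schmidt distance
    of G and sqrt Z s^(1/2) is zero. *)
Lemma klein : tr s = 1 -> 0 < sqnorm ->
  0 <= ent /\ (ent = 0 -> G = inj K (Num.sqrt sqnorm) *: pw 2^-1 s).
Proof.
move=> s1 Z0; have g0 i := psd_ev K i pG.
pose k (p : 'I_n * 'I_n) := ev K G p.1 ^+ 2 *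
  (2 * ln (ev K G p.1) - ln (ev K s p.2) - ln sqnorm) - ev K G p.1 ^+ 2 +
  sqnorm * ev K s p.2.
have kP p := klein_scalar (g0 p.1) (s0 p.2) Z0.
have entE : ent = \sum_p ovl K G s p.1 p.2 * k p.
  have e1 : sqnorm = \sum_(p : 'I_n * 'I_n) ovl K G s p.1 p.2 * ev K s p.2 * sqnorm.
    have := rtr_fcalr id; rewrite (fcal_id K (psd_herm ps)) s1 => e.
    by rewrite -mulr_suml -e mul1r.
  rewrite /ent /relent; transitivity (\sum_(p : 'I_n * 'I_n) (ovl K G s p.1 p.2 *
    (ev K G p.1 ^+ 2 * (2 * ln (ev K G p.1) - ln (ev K s p.2))) -
    ovl K G s p.1 p.2 * ev K G p.1 ^+ 2 * ln sqnorm -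
    ovl K G s p.1 p.2 * ev K G p.1 ^+ 2 + ovl K G s p.1 p.2 * ev K s p.2 * sqnorm)).
    rewrite big_split !sumrB /= -mulr_suml -(sqnorm_sum K s pG) -e1.
    ring.
  by apply: eq_bigr => p _; rewrite /k; ring.
have k0 p : 0 <= ovl K G s p.1 p.2 * k p.
  by rewrite mulr_ge0 ?ovl_ge0 //; have [] := kP p.
rewrite entE; split; first exact: sumr_ge0.
move=> /eqP; rewrite psumr_eq0 // => /allP h.
have H (p : 'I_n * 'I_n) : ovl K G s p.1 p.2 * (ev K G p.1 -
    Num.sqrt sqnorm * ev K s p.2 `^ 2^-1) ^+ 2 = 0.
  have := h p; rewrite mem_index_enum => /(_ isT) /=.
  rewrite mulf_eq0 => /orP[/eqP->|kp0]; first by rewrite mul0r.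
  have [_] := kP p; rewrite eq_sym -/(k p) kp0 => /esym/eqP ->.
  by rewrite subrr expr0n mulr0.
have -> : inj K (Num.sqrt sqnorm) *: pw 2^-1 s =
    fc (fun x => Num.sqrt sqnorm * x `^ 2^-1) s.
  rewrite /fpow !fcalE scalemxAl scalemxAr; congr (_ *m _ *m _).
  by apply/matrixP => i j; rewrite !mxE rmorphM mulrnAr.
set f := fun x : R => _.
apply/eqP; rewrite -subr_eq0; apply/eqP/rtr_gram_eq0.
have -> : (G - fc f s)^t* = G - fc f s.
  have hG : G^t* = G by exact: psd_herm.
  have hs : (fc f s)^t* = fc f s by exact: fcal_herm.
  by apply/matrixP => i j; rewrite -[in RHS]hG -[in RHS]hs !mxE rmorphB.
have -> : tr ((G - fc f s) *m (G - fc f s)) =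
    tr (G *m G) - tr (G *m fc f s) - tr (G *m fc f s) + tr (fc f s *m fc f s).
  rewrite mulmxBl !mulmxBr !rtrB (rtrC _ (fc f s) G); ring.
have -> : tr (G *m G) = \sum_(p : 'I_n * 'I_n) ovl K G s p.1 p.2 * ev K G p.1 ^+ 2.
  exact: sqnorm_sum.
have -> : tr (G *m fc f s) =
    \sum_(p : 'I_n * 'I_n) ovl K G s p.1 p.2 * (ev K G p.1 * f (ev K s p.2)).
  by rewrite -{1}(fcal_id K (psd_herm pG)) rtr_fcalM.
rewrite fcalM rtr_fcalr -!sumrB -big_split big1 //= => p _.
by rewrite -[RHS](H p) /f; ring.
Qed.

Lemma sqnorm_eq0 : sqnorm = 0 -> G = 0.
Proof. by move=> Z0; apply: rtr_gram_eq0; rewrite (psd_herm pG). Qed.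

End Klein.

(** * The weighted norms and the entropy in terms of G *)
Section Identification.
Context {R : realType} {C : numClosedFieldType}.
Context (K : complexification R C) {n : nat}.
Local Notation fc := (fcal K).
Local Notation tr := (rtr K).
Local Notation pw := (fpow K).
Variables (s Y : 'M[C]_n).
Hypotheses (s0 : forall i, 0 < ev K s i) (pY : psd Y).

Definition gammah := pw 4^-1 s *m Y *m pw 4^-1 s.

Lemma gammah_psd : psd gammah.
Proof. by have := psd_congr (pw 4^-1 s) pY; rewrite fpow_herm. Qed.

Lemma fpow0 : pw 0 s = 1%:M.
Proof. by rewrite -(fcal1 K s); apply: eq_fcal => i; rewrite powRr0. Qed.

Lemma fpow_abs (M : 'M[C]_n) : psd M -> pw 2^-1 (M^t* *m M) = M.
Proof.
move=> pM; have hM := psd_herm pM; rewrite -[RHS](fcal_id K hM).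
rewrite hM -{1 2}(fcal_id K hM) fcalM /fpow fcal_comp.
apply: eq_fcal => i /=; have m0 : 0 <= ev K M i by exact: psd_ev.
rewrite powRM // -powRD; last by apply/implyP => /eqP; lra.
by have -> : 2^-1 + 2^-1 = 1 :> R; [lra | rewrite powRr1].
Qed.

(** With W = G^(1/2) s^(v/2), the matrix S Y S is W^t* W, hence its own modulus,
    and W W^t* is N_v. *)
Lemma weighted_norm_interp q : 0 < q -> let S := pw (2 * q)^-1 s in
  tr (pw q (pw 2^-1 ((S *m Y *m S)^t* *m (S *m Y *m S)))) `^ q^-1 =
  interp_norm K s gammah (q^-1 - 2^-1).
Proof.
move=> q0 S; set v := q^-1 - 2^-1.
pose g := pw 2^-1 gammah; pose W := g *m pw (v / 2) s.
have hW : W^t* = pw (v / 2) s *m g by rewrite trmxCM !fpow_herm.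
have -> : S *m Y *m S = W^t* *m W.
  have -> : W^t* *m W = (pw (v / 2) s *m pw 4^-1 s) *m Y *m
      (pw 4^-1 s *m pw (v / 2) s).
    rewrite hW /W; transitivity (pw (v / 2) s *m (g *m g) *m pw (v / 2) s).
      by rewrite !mulmxA.
    by rewrite (fpow_half K gammah_psd) /gammah !mulmxA.
  rewrite (fpowD (v / 2) 4^-1 s0) (fpowD 4^-1 (v / 2) s0) /S.
  have -> : v / 2 + 4^-1 = (2 * q)^-1 by rewrite /v; field; rewrite gt_eqF.
  by have -> : 4^-1 + v / 2 = (2 * q)^-1 by rewrite /v; field; rewrite gt_eqF.
rewrite fpow_abs; last exact: psd_gram.
have WW : W *m W^t* = interp K s gammah v.
  rewrite hW /W; transitivity (g *m (pw (v / 2) s *m pw (v / 2) s) *m g).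
    by rewrite !mulmxA.
  by rewrite (fpowD (v / 2) (v / 2) s0) -splitr.
have iso : tr (pw q (W *m W^t*)) = tr (pw q (W^t* *m W)).
  apply: (@rtr_iso _ _ K n _ (fun x => x `^ (q - 1)) W) => x x0.
  by rewrite mulr_powRB1.
rewrite -iso WW.
have -> : q^-1 = 2^-1 + v by rewrite /v; ring.
rewrite /interp_norm /interp_tr.
by have -> : (2^-1 + v)^-1 = q by rewrite /v addrC subrK invrK.
Qed.

Lemma interp_norm0 : interp_norm K s gammah 0 ^+ 2 = sqnorm K gammah.
Proof.
rewrite /interp_norm /interp_tr /interp fpow0 mulmx1 (fpow_half K gammah_psd).
rewrite addr0 invrK.
rewrite -powR_mulrn ?powR_ge0 // -powRrM mulVf ?pnatr_eq0 //.
have -> : tr (pw 2 gammah) = sqnorm K gammah.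
  rewrite (sqnormE K gammah_psd); congr tr; apply: eq_fcal => i.
  by rewrite powR_mulrn // psd_ev //; exact: gammah_psd.
by rewrite powRr1 // sqnorm_ge0 //; exact: gammah_psd.
Qed.

Lemma ent_logE :
  tr ((gammah *m gammah) *m (fc (@ln R) (gammah *m gammah) - fc (@ln R) s)) =
  relent K s gammah.
Proof.
have hG := psd_herm gammah_psd.
have g0 i : 0 <= ev K gammah i by apply: psd_ev; exact: gammah_psd.
have -> : gammah *m gammah = fc (fun x => x ^+ 2) gammah.
  by rewrite -{1 2}(fcal_id K hG) fcalM.
rewrite fcal_comp mulmxBr rtrB fcalM -[fc _ gammah]mulmx1 -(fcal1 K s).
rewrite !rtr_fcalM -sumrB /relent; apply: eq_bigr => p _ /=.
have -> : ln (ev K gammah p.1 ^+ 2) = 2 * ln (ev K gammah p.1).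
  by rewrite -powR_mulrn // ln_powR.
by ring.
Qed.

Lemma gammah_inv : Y = pw (- 4^-1) s *m gammah *m pw (- 4^-1) s.
Proof.
transitivity ((pw (- 4^-1) s *m pw 4^-1 s) *m Y *m (pw 4^-1 s *m pw (- 4^-1) s)).
  by rewrite (fpowD _ _ s0) (fpowD _ _ s0) addNr subrr fpow0 mulmx1 mul1mx.
by rewrite /gammah !mulmxA.
Qed.

(** The equality case of Klein's inequality, read on Y. *)
Lemma gammah_sqrt_scalar c : gammah = c *: pw 2^-1 s -> Y = c *: 1%:M.
Proof.
move=> GE; rewrite gammah_inv GE -scalemxAr -scalemxAl !fpowD //.
have -> : - 4^-1 + 2^-1 - 4^-1 = 0 :> R by lra.
by rewrite fpow0.
Qed.

End Identification.

(** * Complex matrices *)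
Section Instance.
Context {R : realType}.
Local Notation C := (Cx R).

HB.instance Definition _ := GRing.RMorphism.copy (@RtoC R) (real_complex R).

Lemma ReC_is_zmod_morphism : zmod_morphism (@ReC R).
Proof. by move=> x y; rewrite /ReC; exact: (raddfB (@complex.Re R)). Qed.

HB.instance Definition _ :=
  GRing.isZmodMorphism.Build C R (@ReC R) ReC_is_zmod_morphism.

Lemma RtoC_ReC (z : C) : z \is Num.real -> RtoC (ReC z) = z.
Proof.
rewrite /ReC /RtoC; case: z => a b.
move=> h; have := conj_Creal h => /(congr1 (@complex.Im R)) /= hb.
by apply/eqP; rewrite eq_complex /= eqxx /=; apply/eqP; lra.
Qed.

Lemma RtoC_ge0 (x : R) : (0 <= RtoC x) = (0 <= x).
Proof. by rewrite /RtoC lecE /= eqxx. Qed.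

Lemma ReC_RtoCM (x : R) (z : C) : ReC (RtoC x * z) = x * ReC z.
Proof. by rewrite /ReC /RtoC; case: z => a b /=; rewrite mul0r subr0. Qed.

Lemma RtoCK : cancel (@RtoC R) (@ReC R).
Proof. by []. Qed.

Definition CxK : complexification R C :=
  @Complexification R C (@RtoC R) (@ReC R) RtoCK RtoC_ReC RtoC_ge0 ReC_RtoCM.

End Instance.

Section Transfer.
Context {R : realType} {n : nat}.
Local Notation C := (Cx R).
Variables (sigma Y : 'M[C]_n).
Hypotheses (ps : psdmx sigma) (rs : full_rank sigma) (pY : psdmx Y).
Local Notation G := (gammah CxK sigma Y).

Let s0 : forall i, 0 < ev CxK sigma i.
Proof. by move=> i; exact: (full_rank_ev CxK i ps rs). Qed.

Let pG : psd G. Proof. exact: (gammah_psd CxK sigma pY). Qed.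

Lemma wnormE q : 0 < q -> wnorm q sigma Y = interp_norm CxK sigma G (q^-1 - 2^-1).
Proof. by move=> q0; exact: (weighted_norm_interp s0 pY q0). Qed.

Lemma wnorm2E : wnorm 2 sigma Y ^+ 2 = sqnorm CxK G.
Proof.
have e : interp_norm CxK sigma G (2^-1 - 2^-1) = interp_norm CxK sigma G 0.
  exact: (f_equal (interp_norm CxK sigma G) (subrr _)).
have e2 := etrans (wnormE (ltr0n R 2)) e.
exact: (etrans (f_equal (fun x : R => x ^+ 2) e2) (interp_norm0 CxK sigma pY)).
Qed.

Lemma VarqE q : 0 < q ->
  Varq q sigma Y = sqnorm CxK G - interp_norm CxK sigma G (q^-1 - 2^-1) ^+ 2.
Proof.
move=> q0.
exact: (f_equal2 (fun a b : R => a - b ^+ 2) wnorm2E (wnormE q0)).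
Qed.

Lemma Ent2E : Ent2 sigma Y = ent CxK sigma G.
Proof.
exact: (f_equal2 (fun a b : R => a - b * ln b) (ent_logE CxK sigma pY) wnorm2E).
Qed.

Lemma Varq_le_Ent2 q : 0 < q < 2 ->
  q * Varq q sigma Y <= (2 - q) * Ent2 sigma Y.
Proof.
move=> /andP[q0 q2]; rewrite (VarqE q0) Ent2E.
have v0 : 0 < q^-1 - 2^-1 by rewrite subr_gt0 ltf_pV2 ?posrE.
have := var_le_ent s0 pG v0 => /(ler_wpM2l (ltW q0)).
move: (ent _ _ _) (sqnorm _ _ - _) => e z.
have -> // : q * (2 * (q^-1 - 2^-1) * e) = (2 - q) * e.
by field; rewrite gt_eqF.
Qed.

Lemma Ent2_le0_scalar : \tr sigma = 1 -> Ent2 sigma Y <= 0 ->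
  Ent2 sigma Y = 0 /\ exists c : C, Y = c *: 1%:M.
Proof.
move=> s1; rewrite Ent2E.
have := sqnorm_ge0 CxK pG; rewrite le_eqVlt => /orP[/eqP Z0|Z0].
  have e0 := ent_sqnorm0 sigma pG (esym Z0) => _; split=> //.
  exists 0; apply: (gammah_sqrt_scalar (K := CxK) s0).
  by rewrite scale0r; exact: (sqnorm_eq0 pG (esym Z0)).
have t1 : rtr CxK sigma = 1 by rewrite /rtr s1.
have [e0 eG] := klein ps s0 pG t1 Z0; move=> ele.
have ee : ent CxK sigma G = 0 by apply/eqP; rewrite eq_le ele e0.
split=> //; exists (inj CxK (Num.sqrt (sqnorm CxK G))).
exact: (gammah_sqrt_scalar s0 (eG ee)).
Qed.

(** [var_ge_first_order] in terms of q, with 4 c in place of c: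
    q/2 * 4 c (1/q - 1/2) = c (2 - q). *)
Lemma Varq_ge_near2 c : 0 < Ent2 sigma Y -> c < 2^-1 * Ent2 sigma Y ->
  \forall q \near (2 : R)^'-, c * (2 - q) <= q / 2 * Varq q sigma Y.
Proof.
rewrite Ent2E => ent0 ce.
have Z0 : 0 < sqnorm CxK G.
  rewrite lt0r sqnorm_ge0 // andbT; apply/eqP => z0.
  by move: ent0; rewrite (ent_sqnorm0 sigma pG z0) ltxx.
have c2 : 4 * c < 2 * ent CxK sigma G by move: (ent _ _ _) ce => e; lra.
have [e e0 H] := var_ge_first_order s0 pG Z0 c2.
have e1 : 0 < Num.min e 1 by rewrite lt_min e0 ltr01.
near=> q.
have q2 : q < 2 by near: q; exact: nbhs_left_lt.
have q1 : 1 < q by near: q; apply: nbhs_left_gt; lra.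
have qe : 2 - e < q by near: q; apply: nbhs_left_gt; lra.
have q0 : 0 < q by lra.
rewrite (VarqE q0).
have v0 : 0 < q^-1 - 2^-1 by rewrite subr_gt0 ltf_pV2 ?posrE.
have ve : q^-1 - 2^-1 < e.
  have -> : q^-1 - 2^-1 = (2 - q) / (2 * q) by field; rewrite gt_eqF.
  rewrite ltr_pdivrMr; last lra.
  have : e * 1 <= e * (2 * q) by rewrite ler_pM2l //; lra.
  lra.
have := H _ (introT andP (conj v0 ve)).
move: (sqnorm _ _ - _) => z.
have q20 : 0 < q / 2 by lra.
rewrite -(ler_pM2l q20); have -> // : q / 2 * (4 * c * (q^-1 - 2^-1)) = c * (2 - q).
by field; rewrite gt_eqF.
Unshelve. all: by end_near.
Qed.

End Transfer.

(** * The theorem *)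
Section Final.
Context {R : realType}.

Lemma limf_esup_frequently (f : R -> R) (F : set_system R) (V : set R) (a : R) :
  F V -> (a%:E < limf_esup (fun q => (f q)%:E) F)%E ->
  exists2 q, V q & a < f q.
Proof.
move=> FV; rewrite limf_esupE => h.
have : (a%:E < ereal_sup ((fun q => (f q)%:E) @` V))%E.
  by apply: (lt_le_trans h); apply: ereal_inf_lbound; exists V.
move=> /ereal_sup_gt[_ [q Vq <-]]; rewrite lte_fin => aq.
by exists q.
Qed.

(** Test on a = r m and x = r y: if e < m y, then r close to 1 contradicts the
    hypothesis.  With k = e / (m y) < 1, the choice r = (1 + k)/2 works as
    r^2 - k = ((1 - k)/2)^2. *)
Lemma le_mul_of_lt (m y e : R) : 0 < m -> 0 < y ->
  (forall a x, 0 <= a < m -> 0 < x < y -> a * x <= e) -> m * y <= e.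
Proof.
move=> m0 y0 H; rewrite leNgt; apply/negP => emy.
have e0 : 0 <= e.
  by have := H 0 (y / 2); rewrite mul0r; apply; apply/andP; split; lra.
have my0 : 0 < m * y by rewrite mulr_gt0.
pose k := e / (m * y).
have k0 : 0 <= k by rewrite divr_ge0 // ltW.
have k1 : k < 1 by rewrite ltr_pdivrMr // mul1r.
have ek : e = k * (m * y) by rewrite /k divfK // gt_eqF.
pose r := (1 + k) / 2.
have r0 : 0 < r by rewrite /r; lra.
have r1 : r < 1 by rewrite /r; lra.
have mr : 0 <= m * r < m by rewrite (ltW (mulr_gt0 _ _)) //= gtr_pMr.
have yr : 0 < y * r < y by rewrite mulr_gt0 //= gtr_pMr.
have := H _ _ mr yr.
have -> : m * r * (y * r) = r ^+ 2 * (m * y) by ring.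
rewrite ek ler_pM2r // leNgt; apply/negP; rewrite negbK.
rewrite -subr_gt0 (_ : r ^+ 2 - k = ((1 - k) / 2) ^+ 2); last by rewrite /r; field.
by rewrite exprn_gt0 //; lra.
Qed.

(** Dividing by 2 - q gives a x <= q/2 * d; then d >= 0, and q/2 <= 1. *)
Lemma beckner_at_q (a b q v x d : R) : 0 <= a -> a < b -> 0 < q -> q < 2 ->
  0 < x -> x * (2 - q) <= q / 2 * v -> b * v <= (2 - q) * d -> a * x <= d.
Proof.
move=> a0 ab q0 q2 x0 xv bd.
have q20 : 0 < 2 - q by lra.
have qh : 0 < q / 2 by lra.
have v0 : 0 < q / 2 * v by apply: lt_le_trans xv; rewrite mulr_gt0.
have av : a * (q / 2 * v) <= b * (q / 2 * v) by rewrite ler_pM2r // ltW.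
have h : a * x * (2 - q) <= q / 2 * d * (2 - q).
  rewrite -mulrA; apply: (le_trans (ler_wpM2l a0 xv)).
  apply: (le_trans av); rewrite mulrCA -[X in _ <= X]mulrA (mulrC d).
  by rewrite ler_pM2l.
rewrite ler_pM2r // in h.
have d0 : 0 <= d.
  have : 0 <= q / 2 * d by apply: le_trans h; rewrite mulr_ge0 // ltW.
  by rewrite pmulr_rge0.
apply: (le_trans h); rewrite ler_piMl //; lra.
Qed.

Context {n : nat} (P : R -> {linear 'M[Cx R]_n -> 'M[Cx R]_n})
  (L : {linear 'M[Cx R]_n -> 'M[Cx R]_n}).

(** The difference quotient of t |-> P t 1 is identically zero. *)
Lemma generator1 : qms P -> generator P L -> L 1%:M = 0.
Proof.
move=> qP gL; have h0 := gL 1%:M.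
have h1 : RtoC t^-1 *: (P t 1%:M - 1%:M) @[t --> (0 : R)^'+] --> (0 : 'M[Cx R]_n).
  apply: cvg_near_cst; near=> t.
  have t0 : 0 < t by near: t; exact: nbhs_right_gt.
  by rewrite (qms_unital qP (ltW t0)) subrr scaler0.
exact: (cvg_unique _ h0 h1).
Unshelve. all: by end_near.
Qed.

Lemma dirichlet2_scalar sigma (c : Cx R) : L 1%:M = 0 ->
  dirichlet2 sigma L (c *: 1%:M) = 0.
Proof.
move=> L1; have Lc : L (c *: 1%:M) = 0 by rewrite linearZ_LR L1 scaler0.
by rewrite /dirichlet2 /kmsdot Lc mulmx0 mxtrace0 /ReC /= oppr0.
Qed.

End Final.

(* In (a), a real beta >= (limsup) / 2 is found by taking l = limsup when the
   latter is finite. It is infinite only in dimension 1, where the statement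
   reads: (LSI) holds with arbitrarily large constants. *)
Theorem proposition3p10 :
  forall (R : realType) (n : nat)
    (P : R -> {linear 'M[Cx R]_n -> 'M[Cx R]_n})
    (L : {linear 'M[Cx R]_n -> 'M[Cx R]_n})
    (sigma : 'M[Cx R]_n),
  qms P -> generator P L ->
  primitive P sigma ->
  kms_detailed_balance sigma L ->
  (forall beta : R -> R,
     (forall q, 0 < q < 2 -> dual_Beckner sigma L q (beta q)) ->
     (0 < limf_esup (fun q => (beta q)%:E) (2 : R)^'-)%E ->
     forall l : R, (l%:E <= limf_esup (fun q => (beta q)%:E) (2 : R)^'-)%E ->
     exists2 b : R, 2^-1 * l <= b & LSI sigma L b)
  /\
  (forall beta : R, 0 < beta -> LSI sigma L beta ->
     forall q, 0 < q < 2 ->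
     exists2 bq : R, q * beta <= bq & dual_Beckner sigma L q bq).
Proof.
move=> R n P L sigma qP gL [[[ps s1] _] _ rs] _; split; last first.
  move=> beta b0 lsi q q02; exists (q * beta) => // Y pY.
  have /andP[q0 q2] := q02.
  have := Varq_le_Ent2 ps rs pY q02 => /(ler_wpM2l (ltW b0)).
  have q20 : 0 <= 2 - q by rewrite subr_ge0 ltW.
  have := lsi Y pY => /(ler_wpM2l q20).
  move: (Varq _ _ _) (Ent2 _ _) (dirichlet2 _ _ _) => v e d h1 h2.
  have -> : q * beta * v = beta * (q * v) by ring.
  apply: (le_trans h2); have -> // : beta * ((2 - q) * e) = (2 - q) * (beta * e).
  by ring.
move=> beta bec lim0 l llim.
have L1 := generator1 qP gL.
exists (2^-1 * Num.max l 0); first by rewrite ler_pM2l ?invr_gt0 // le_max lexx.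
move=> Y pY; have [Ele0|Egt0] := leP (Ent2 sigma Y) 0.
  have [E0 [c Yc]] := Ent2_le0_scalar ps rs pY s1 Ele0.
  by rewrite E0 mulr0 Yc dirichlet2_scalar.
have claim a x : 0 <= a ->
    (a%:E < limf_esup (fun q => (beta q)%:E) (2 : R)^'-)%E ->
    0 < x < 2^-1 * Ent2 sigma Y -> a * x <= dirichlet2 sigma L Y.
  move=> a0 alim /andP[x0 xE].
  have near_q : \forall q \near (2 : R)^'-,
      0 < q < 2 /\ x * (2 - q) <= q / 2 * Varq q sigma Y.
    near=> q; split; last by near: q; exact: Varq_ge_near2.
    by apply/andP; split; near: q; [apply: nbhs_left_gt | exact: nbhs_left_lt].
  have [q [q02 xV] aq] := limf_esup_frequently near_q alim.
  have := bec q q02 Y pY; have /andP[q0 q2] := q02.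
  move: (Varq _ _ _) (dirichlet2 _ _ _) xV => v d xV vd.
  exact: (beckner_at_q (q := q) (v := v) (b := beta q)).
have [l0|lpos] := leP l 0.
  rewrite mulr0 mul0r.
  have := claim 0 (2^-1 * (2^-1 * Ent2 sigma Y)) (lexx 0) lim0.
  rewrite mul0r; apply; move: (Ent2 _ _) Egt0 => e e0.
  by apply/andP; split; lra.
rewrite (mulrC 2^-1) -mulrA; apply: le_mul_of_lt => //.
  by rewrite mulr_gt0 ?invr_gt0.
move=> a x /andP[a0 al] x01; apply: claim => //.
by apply: lt_le_trans llim; rewrite lte_fin.
Unshelve. all: by end_near.
Qed.
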